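(* Let $n\ge2$. The rational polygonal $n$-cone is semistable if and only if $2\le n\le6$. Moreover, it is stable if and only if $2\le n\le5$.
   Context: All rings are commutative, Noetherian, with $1$. For a local ring $(R,\mathfrak m)$ of dimension $d$ and an $\mathfrak m$-primary ideal $I$, $\ell$ denotes length and $e(I)=\lim_{m\to\infty} d!\,\ell(R/I^m)/m^d$ is the Hilbert--Samuel multiplicity. The Lech--Mumford constant is $c_{LM}(R)=\sup_{\sqrt I=\mathfrak m}\frac{e(I)}{d!\,\ell(R/I)}$. $R$ is semistable if $c_{LM}(R[[T]])=1$; stable if it is semistable and the supremum defining $c_{LM}(R[[T]])$ is not attained. Let $k$ be a field and $n\ge2$. The rational polygonal $n$-cone is (the completed affine cone over a chain of $n$ generic line segments in $\mathbb{P}^n$) the local ring $k[[x_1,\dots,x_{n+1}]]/(P_1\cap\cdots\cap P_n)$, where $P_1=(x_1,\dots,x_{n-1})$, $P_2=(x_2,\dots,x_n)$, $\dots$, $P_n=(x_n,x_{n+1},x_1,\dots,x_{n-3})$, i.e. for $1\le i\le n$, $P_i=(x_i,x_{i+1},\dots,x_{i+n-2})$ with indices modulo $n+1$ (each $P_i$ is generated by $n-1$ cyclically consecutive variables). *)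

(* Defs.v *)
From HB Require Import structures.
From mathcomp Require Import all_boot all_order all_algebra.
From mathcomp Require Import ring_quotient.
(* mpoly must be required before the analysis files: the converse order makes
   their notations clash. *)
From mathcomp Require Import mpoly.
From mathcomp Require Import boolp classical_sets reals ereal topology.
From mathcomp Require Import normedtype sequences.

Set Implicit Arguments.
Unset Strict Implicit.
Unset Printing Implicit Defensive.

Import Order.TTheory GRing.Theory Num.Theory.
Import numFieldNormedType.Exports.

Local Open Scope classical_set_scope.
Local Open Scope ring_scope.

(* R[[x_0, ..., x_(m-1)]]: arbitrary families of coefficients indexed by the
   exponents 'X_{1..m}.  The record is there to keep the Cauchy product apart
   from the pointwise product of functions. *)
Record powerseries (m : nat) (R : comNzRingType) : Type :=
  PSeries { pscoef : 'X_{1..m} -> R }.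

HB.instance Definition _ m R := gen_eqMixin (powerseries m R).
HB.instance Definition _ m R := gen_choiceMixin (powerseries m R).

Section PowerSeries.
Variables (m : nat) (R : comNzRingType).
Implicit Types f g h : powerseries m R.

Definition ps0 : powerseries m R := PSeries (fun=> 0).
Definition ps1 : powerseries m R := PSeries (fun a => (a == 0%MM)%:R).
Definition psopp f : powerseries m R := PSeries (fun a => - pscoef f a).
Definition psadd f g : powerseries m R :=
  PSeries (fun a => pscoef f a + pscoef g a).

(* The bounds on the degrees of k.1 and k.2 only make the index type finite:
   they follow from a = k.1 + k.2. *)
Definition psmul f g : powerseries m R := PSeries (fun a =>
  \sum_(k : 'X_{1..m < (mdeg a).+1, (mdeg a).+1} | a == (k.1 + k.2)%MM)
     pscoef f k.1 * pscoef g k.2).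

Definition psvar (i : 'I_m) : powerseries m R :=
  PSeries (fun a => (a == U_(i)%MM)%:R).

Lemma psP f g : pscoef f =1 pscoef g -> f = g.
Proof. by case: f g => [f] [g] /= /funext ->. Qed.

Definition pstrunc (d : nat) f : {mpoly R[m]} :=
  \sum_(a : 'X_{1..m < d.+1}) pscoef f a *: 'X_[a].

Lemma pstruncE d f a : (mdeg a <= d)%N -> (pstrunc d f)@_a = pscoef f a.
Proof. by move=> ad; rewrite (mcoeff_mpoly (pscoef f)). Qed.

Lemma psmulE d p q f g a :
    (forall b, (mdeg b <= d)%N -> p@_b = pscoef f b) ->
    (forall b, (mdeg b <= d)%N -> q@_b = pscoef g b) ->
  (mdeg a <= d)%N -> (p * q)@_a = pscoef (psmul f g) a.
Proof.
move=> pf qg ad; rewrite mcoeffM /=; apply: eq_bigr => k _.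
have le_d (b : 'X_{1..m < (mdeg a).+1}) : (mdeg b <= d)%N.
  by apply: leq_trans ad; rewrite -ltnS bmdeg.
by rewrite pf ?qg.
Qed.

Fact psaddA : associative psadd.
Proof. by move=> f g h; apply: psP => a /=; rewrite addrA. Qed.

Fact psaddC : commutative psadd.
Proof. by move=> f g; apply: psP => a /=; rewrite addrC. Qed.

Fact psadd0 : left_id ps0 psadd.
Proof. by move=> f; apply: psP => a /=; rewrite add0r. Qed.

Fact psaddN : left_inverse ps0 psopp psadd.
Proof. by move=> f; apply: psP => a /=; rewrite addNr. Qed.

Fact psmulA : associative psmul.
Proof.
move=> f g h; apply: psP => a.
have T f' b : (mdeg b <= mdeg a)%N -> (pstrunc (mdeg a) f')@_b = pscoef f' b.
  exact: pstruncE.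
have M f' g' b : (mdeg b <= mdeg a)%N ->
    (pstrunc (mdeg a) f' * pstrunc (mdeg a) g')@_b = pscoef (psmul f' g') b.
  by apply: psmulE; apply: T.
rewrite -(psmulE (T f) (M g h) (leqnn _)).
by rewrite -(psmulE (M f g) (T h) (leqnn _)) mulrA.
Qed.

Fact psmulC : commutative psmul.
Proof.
move=> f g; apply: psP => a.
by do 2!rewrite -(psmulE (@pstruncE _ _) (@pstruncE _ _) (leqnn _)) 1?mulrC.
Qed.

Fact psmul1 : left_id ps1 psmul.
Proof.
move=> f; apply: psP => a.
have one b : (mdeg b <= mdeg a)%N -> (1 : {mpoly R[m]})@_b = pscoef ps1 b.
  by move=> _; rewrite mcoeff1.
by rewrite -(psmulE one (@pstruncE _ f) (leqnn _)) mul1r pstruncE.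
Qed.

Fact psmulDl : left_distributive psmul psadd.
Proof.
move=> f g h; apply: psP => a /=.
by rewrite -big_split; apply: eq_bigr => k _; rewrite mulrDl.
Qed.

Fact ps1_neq0 : ps1 != ps0.
Proof.
apply/eqP => /(congr1 (fun f => pscoef f 0%MM)) /= /eqP.
by rewrite eqxx oner_eq0.
Qed.

End PowerSeries.

HB.instance Definition _ m R := GRing.isZmodule.Build (powerseries m R)
  (@psaddA m R) (@psaddC m R) (@psadd0 m R) (@psaddN m R).
HB.instance Definition _ m R := GRing.Zmodule_isComNzRing.Build (powerseries m R)
  (@psmulA m R) (@psmulC m R) (@psmul1 m R) (@psmulDl m R) (@ps1_neq0 m R).

Section Ideals.
Variable R : comNzRingType.
Implicit Types I J P : set R.

Definition is_ideal I : Prop :=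
  [/\ I 0, (forall x y, I x -> I y -> I (x + y)) &
      (forall a x, I x -> I (a * x))].

Definition is_prime_ideal P : Prop :=
  [/\ is_ideal P, ~ P 1 & forall x y, P (x * y) -> P x \/ P y].

Definition ideal_gen (S : set R) : set R := smallest is_ideal S.

Definition ideal_mul I J : set R :=
  ideal_gen [set x | exists a b, [/\ I a, J b & x = a * b]].

Definition ideal_exp I (n : nat) : set R := iter n (ideal_mul I) setT.

Definition radical I : set R := [set x | exists n, I (x ^+ n)].

(* The maximal ideal of a local ring, as the set of its non-units. *)
Definition max_ideal : set R := [set x | ~ exists y, x * y = 1].

Definition m_primary I : Prop := is_ideal I /\ radical I = max_ideal.

End Ideals.

Section Quotient.
Variables (R : comNzRingType) (J : set R) (idJ : is_ideal J) (J1 : ~ J 1).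

Let ideal_pred : {pred R} := fun x => `[< J x >].

Fact ideal_pred_closed : idealr_closed ideal_pred.
Proof.
case: (idJ) => J0 JD JM; split; first exact/asboolP.
- exact/asboolPn.
- by move=> a x y /asboolP Jx /asboolP Jy; apply/asboolP/JD => //; apply: JM.
Qed.

Definition proper_idealr : idealr R :=
  HB.pack ideal_pred (isIdealr.Build R ideal_pred ideal_pred_closed).

Definition quotient_ring : comNzRingType := {ideal_quot proper_idealr}.

End Quotient.

(* The greatest element of A, and 0 if A is empty or unbounded.  The two uses
   below are on nonempty sets that are bounded when R is a Noetherian local ring
   and I is primary to its maximal ideal. *)
Definition nat_max (A : set nat) : nat :=
  xget 0%N [set d | A d /\ forall n, A n -> (n <= d)%N].

(* The lengths n of the chains c 0 < c 1 < ... < c n of members of C. *)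
Definition chain_lengths (T : Type) (C : set (set T)) : set nat :=
  [set n | exists c : nat -> set T,
    (forall i, (i <= n)%N -> C (c i)) /\
    (forall i, (i < n)%N -> c i `<` c i.+1)].

Section LechMumford.
Variables (K : realType) (R : comNzRingType).
Implicit Type I : set R.

Definition krull_dim : nat := nat_max (chain_lengths (@is_prime_ideal R)).

(* The length of the R-module R/I, i.e., the greatest length of a chain of
   submodules; the submodules of R/I are the J/I, for J an ideal containing
   I. *)
Definition length_quot I : nat :=
  nat_max (chain_lengths [set J | is_ideal J /\ I `<=` J]).

Definition multiplicity I : K :=
  lim ((fun n : nat => (krull_dim`!)%:R * (length_quot (ideal_exp I n))%:R
                       / n%:R ^+ krull_dim : K) @ \oo).

Definition lech_ratio I : K :=
  multiplicity I / ((krull_dim`!)%:R * (length_quot I)%:R).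

Definition lech_mumford : \bar K :=
  ereal_sup [set (lech_ratio I)%:E | I in @m_primary R].

Definition lech_mumford_attained : Prop :=
  exists2 I, m_primary I & (lech_ratio I)%:E = lech_mumford.

End LechMumford.

(* powerseries 1 R is R[[T]]. *)
Definition semistable (K : realType) (R : comNzRingType) : Prop :=
  lech_mumford K (powerseries 1 R) = 1%E.

Definition stable (K : realType) (R : comNzRingType) : Prop :=
  semistable K R /\ ~ lech_mumford_attained K (powerseries 1 R).

Section PolygonalCone.
Variables (k : fieldType) (n : nat).

(* Variables and primes are numbered from 0, and inZp reduces modulo n.+1. *)
Definition cone_prime (i : 'I_n) : set (powerseries n.+1 k) :=
  ideal_gen [set psvar k (inZp (i + j)%N) | j in [set j | (j < n.-1)%N]].

Definition cone_ideal : set (powerseries n.+1 k) := \bigcap_i cone_prime i.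

Fact ideal_gen_ideal (R : comNzRingType) (S : set R) : is_ideal (ideal_gen S).
Proof.
split.
- by move=> A [[]].
- move=> x y xS yS A [iA SA].
  by have [_ AD _] := iA; apply: AD; [apply: xS | apply: yS].
- move=> a x xS A [iA SA].
  by have [_ _ AM] := iA; apply: AM; apply: xS.
Qed.

Fact cone_ideal_ideal : is_ideal cone_ideal.
Proof.
have idP i := ideal_gen_ideal
  [set psvar k (inZp (i + j)%N : 'I_n.+1) | j in [set j | (j < n.-1)%N]].
split.
- by move=> i _; have [+ _ _] := idP i; apply.
- move=> x y Px Py i _.
  by have [_ PD _] := idP i; apply: PD; [apply: Px | apply: Py].
- by move=> a x Px i _; have [_ _ PM] := idP i; apply: PM; apply: Px.
Qed.

Fact cone_ideal_proper : (2 <= n)%N -> ~ cone_ideal 1.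
Proof.
move=> n2 /(_ (Ordinal (ltnW n2)) I) /(_ [set f | pscoef f 0%MM = 0]) /=.
suff H : is_ideal [set f : powerseries n.+1 k | pscoef f 0%MM = 0].
  move=> /(_ (conj H _)) one0.
  have /eqP : pscoef (1 : powerseries n.+1 k) 0%MM = 0.
    apply: one0 => f [j _ <-] /=.
    case: eqP => // /(congr1 mdeg).
    by rewrite mdeg0 mdeg1.
  by rewrite /= eqxx oner_eq0.
split => //=.
- by move=> f g /= -> ->; rewrite addr0.
- move=> f g /= g0; apply: big1 => -[b c] /= /eqP bc0.
  suff /eqP -> : bmnm c == 0%MM by rewrite g0 mulr0.
  have := congr1 mdeg bc0; rewrite [LHS]mdeg0 mdegD => /esym/eqP.
  by rewrite addn_eq0 => /andP[_]; rewrite mdeg_eq0.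
Qed.

Definition polygonal_cone (n2 : (2 <= n)%N) : comNzRingType :=
  quotient_ring cone_ideal_ideal (cone_ideal_proper n2).

End PolygonalCone.

(* Main.v *)
(* The cone [R] is the Stanley-Reisner ring of a path, so [R[[T]]] is the quotient
   of [Q = k[[x_0, ..., x_n, T]]] by the monomials outside a chain of [n] octants
   glued along faces.  For an [m]-primary ideal [I], pulled back to [Q], the length
   of [R[[T]] / I] is the number of exponents that are not leading exponents of
   elements of [I], that is, the sum over the lattice points [v] of the chain of
   [n] quadrants of the height [h v], the least [c] with [(v, c)] leading.
   Triangulate each quadrant by cutting every unit square along its antidiagonal.
   A lattice point of the [q]-th dilate of a triangle [v1, v2, v3] is an integral
   combination [x v1 + y v2 + z v3] with [x + y + z = q], and its height for [I^q]
   is at most [x h(v1) + y h(v2) + z h(v3)] since leading exponents add up.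
   Summing over the dilate gives [e(I) <= \sum (h v1 + h v2 + h v3)], the sum being
   over all triangles.  An interior point lies in 6 triangles, a nonzero point of a
   shared ray in 3 + 3, one of an outer ray in 3, and the origin in [n].  Hence
   [e(I) <= 6 len(I) + (n - 6) h(0)], with [h(0) > 0]; this settles [n <= 6].
   In the other direction the powers of the maximal ideal have ratios tending to
   1, and the maximal ideal itself has ratio [n / 6].

   The dimension is bounded by following a chain of primes [P < P'] of [Q]: if [j]
   elements [u] generate an ideal primary to the maximal ideal modulo [P], then
   Cayley-Hamilton gives a nonzero series [g] with [g(u)] in [P'], and after the
   substitution [u_i - u_last ^ N_i], [j - 1] elements suffice modulo [P']. *)
Require Import Defs.
From HB Require Import structures.
From mathcomp Require Import all_boot all_order all_algebra.
From mathcomp Require Import generic_quotient ring_quotient zify ring lra.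
From mathcomp Require Import mpoly.
From mathcomp Require Import boolp classical_sets reals ereal topology.
From mathcomp Require Import normedtype sequences.

Set Implicit Arguments.
Unset Strict Implicit.
Unset Printing Implicit Defensive.

Import Order.TTheory GRing.Theory Num.Theory.

Local Open Scope ring_scope.

(** * Power series *)

Section IdealTheory.
Variables (R : comNzRingType) (J : set R).
Hypothesis idJ : is_ideal J.

Lemma ideal0 : J 0. Proof. by case: idJ. Qed.

Lemma idealD x y : J x -> J y -> J (x + y).
Proof. by case: idJ => _ + _; apply. Qed.

Lemma idealMl a x : J x -> J (a * x).
Proof. by case: idJ => _ _; apply. Qed.

Lemma idealMr a x : J x -> J (x * a).
Proof. by rewrite mulrC; apply: idealMl. Qed.

Lemma idealN x : J x -> J (- x).
Proof. by rewrite -mulN1r; apply: idealMl. Qed.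

Lemma idealB x y : J x -> J y -> J (x - y).
Proof. by move=> Jx /idealN; apply: idealD. Qed.

Lemma idealBr x y : J y -> J (x - y) -> J x.
Proof. by move=> Jy Jxy; rewrite -(subrK y x); apply: idealD. Qed.

Lemma ideal_sum (I : Type) (r : seq I) (P : pred I) (F : I -> R) :
  (forall i, P i -> J (F i)) -> J (\sum_(i <- r | P i) F i).
Proof. by move=> JF; elim/big_rec: _ => [|i x Pi Jx];
  [exact: ideal0 | exact: idealD (JF i Pi) Jx]. Qed.

End IdealTheory.

Lemma prime_idealX (R : comNzRingType) (P : set R) (x : R) m :
  is_prime_ideal P -> P (x ^+ m) -> P x.
Proof.
case=> idP P1 PM; elim: m => [/P1 //|m IH].
by rewrite exprS => /PM[].
Qed.

Section PowerSeriesTheory.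
Variables (m : nat) (R : comNzRingType).
Implicit Types (f g : powerseries m R) (a b w : 'X_{1..m}).

Lemma pscoef1 a : pscoef (1 : powerseries m R) a = (a == 0%MM)%:R.
Proof. by []. Qed.

Lemma pscoefD f g a : pscoef (f + g) a = pscoef f a + pscoef g a.
Proof. by []. Qed.

Lemma pscoefB f g a : pscoef (f - g) a = pscoef f a - pscoef g a.
Proof. by []. Qed.

Lemma pscoef_sum (I : Type) (r : seq I) (P : pred I) (F : I -> powerseries m R) a :
  pscoef (\sum_(i <- r | P i) F i) a = \sum_(i <- r | P i) pscoef (F i) a.
Proof. exact: (big_morph (fun f => pscoef f a) (fun f g => pscoefD f g a)). Qed.

Lemma pscoefM f g a : pscoef (f * g) a =
  \sum_(k : 'X_{1..m < (mdeg a).+1, (mdeg a).+1} | a == (k.1 + k.2)%MM)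
     pscoef f k.1 * pscoef g k.2.
Proof. by []. Qed.

(** Frees the Cauchy product from its bounded index type: any duplicate-free enumeration of the
    decompositions of [a] can replace it. *)
Lemma pscoefM_seq (s : seq ('X_{1..m} * 'X_{1..m})) f g a :
    uniq s -> (forall p, (p \in s) = (a == p.1 + p.2)%MM) ->
  pscoef (f * g) a = \sum_(p <- s) pscoef f p.1 * pscoef g p.2.
Proof.
move=> us mems; rewrite pscoefM.
pose v (k : 'X_{1..m < (mdeg a).+1, (mdeg a).+1}) := (bmnm k.1, bmnm k.2).
rewrite -big_filter.
rewrite -[LHS](big_map v xpredT (fun p => pscoef f p.1 * pscoef g p.2)).
apply: perm_big; apply: uniq_perm => //.
  rewrite map_inj_uniq ?filter_uniq ?index_enum_uniq //.
  by move=> [x1 x2] [y1 y2] [/val_inj -> /val_inj ->].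
move=> [b c]; rewrite mems /=; apply/mapP/idP => [[k]|/eqP abc].
  by rewrite mem_filter => /andP[+ _] [-> ->].
have hb : (mdeg b < (mdeg a).+1)%N by rewrite abc mdegD ltnS leq_addr.
have hc : (mdeg c < (mdeg a).+1)%N by rewrite abc mdegD ltnS leq_addl.
exists (BMultinom hb, BMultinom hc) => //.
by rewrite mem_filter mem_index_enum andbT /= abc.
Qed.

Definition psmon w : powerseries m R := PSeries (fun a => (a == w)%:R).

Lemma psvarE i : psvar R i = psmon U_(i)%MM. Proof. by []. Qed.

Lemma pscoef_monM w f a :
  pscoef (psmon w * f) a = if (w <= a)%MM then pscoef f (a - w)%MM else 0.
Proof.
rewrite pscoefM; case: ifP => wa; last first.
  apply: big1 => k /eqP ak /=; case: eqP => [kw|_]; last by rewrite mul0r.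
  by case/negP: wa; rewrite ak kw lem_addr.
have hw : (mdeg w < (mdeg a).+1)%N by rewrite -(submK wa) mdegD ltnS leq_addl.
have ha : (mdeg (a - w)%MM < (mdeg a).+1)%N.
  by rewrite -{2}(submK wa) mdegD ltnS leq_addr.
rewrite (bigD1 (BMultinom hw, BMultinom ha)) /=; last by rewrite addmC submK.
rewrite eqxx mul1r big1 ?addr0 // => k /andP[/eqP ak nk].
case: eqP => [kw|_]; last by rewrite mul0r.
case/eqP: nk; case: k ak kw => k1 k2 /= ak kw.
congr (_, _); apply: val_inj => //=.
by apply: (@addIm _ w); rewrite submK // addmC -kw -ak.
Qed.

Lemma psmonM v w : psmon v * psmon w = psmon (v + w)%MM.
Proof.
apply: psP => a; rewrite pscoef_monM /=; case: ifP => va.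
  by rewrite -(inj_eq (@addmI _ v)) [(v + (a - v))%MM]addmC submK.
by case: eqP => // av; move: va; rewrite av lem_addr.
Qed.

Lemma psmon0 : psmon 0%MM = 1. Proof. by []. Qed.

Lemma psmonX v j : psmon v ^+ j = psmon (v *+ j)%MM.
Proof. by elim: j => [|j IH]; rewrite ?mulm0n // exprS mulmS IH psmonM. Qed.

Definition psC (c : R) : powerseries m R := PSeries (fun a => c *+ (a == 0%MM)).

Lemma pscoef_CM c f a : pscoef (psC c * f) a = c * pscoef f a.
Proof.
rewrite pscoefM; have h0 : (mdeg (0%MM : 'X_{1..m}) < (mdeg a).+1)%N by rewrite mdeg0.
rewrite (bigD1 (BMultinom h0, BMultinom (ltnSn (mdeg a)))) /=; last by rewrite add0m.
rewrite eqxx big1 ?addr0 // => k /andP[/eqP ak nk].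
case: eqP => [kw|_]; last by rewrite mulr0n mul0r.
case/eqP: nk; case: k ak kw => k1 k2 /= ak kw.
by congr (_, _); apply: val_inj => //=; rewrite -[LHS]add0m -kw -ak.
Qed.

Fact psC_zmod : zmod_morphism psC.
Proof. by move=> b c; apply: psP => a /=; rewrite mulrnBl. Qed.

Fact psC_monoid : monoid_morphism psC.
Proof.
split; first exact: psP.
by move=> b c; apply: psP => a; rewrite pscoef_CM /= mulrnAr.
Qed.

HB.instance Definition _ := GRing.isZmodMorphism.Build R (powerseries m R) psC
  psC_zmod.
HB.instance Definition _ := GRing.isMonoidMorphism.Build R (powerseries m R) psC
  psC_monoid.

(** The [d]-th power of the ideal of the variables, described by coefficients so that convergence
    arguments need no generators. *)
Definition ps_ord (d : nat) f : Prop := forall a, (mdeg a < d)%N -> pscoef f a = 0.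

Lemma ps_ord0 f : ps_ord 0 f. Proof. by []. Qed.

Lemma ps_ordW d e f : (e <= d)%N -> ps_ord d f -> ps_ord e f.
Proof. by move=> ed df a ae; apply: df; apply: leq_trans ed. Qed.

Lemma ps_ordM d e f g : ps_ord d f -> ps_ord e g -> ps_ord (d + e) (f * g).
Proof.
move=> df eg a ade; rewrite pscoefM big1 // => k /eqP ak.
case: (ltnP (mdeg k.1) d) => [/df ->|dk]; first by rewrite mul0r.
rewrite (eg k.2) ?mulr0 //; rewrite ltnNge; apply/negP => ek.
by move: ade; rewrite {1}ak mdegD ltnNge leq_add.
Qed.

Lemma ps_ord_ideal d : is_ideal (ps_ord d).
Proof.
split => //.
- by move=> f g df dg a ad; rewrite pscoefD df ?dg ?addr0.
- by move=> h f df; rewrite -[d]add0n; apply: ps_ordM.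
Qed.

Lemma ps_ord_eq0 f : (forall d, ps_ord d f) -> f = 0.
Proof. by move=> df; apply: psP => a; rewrite (df (mdeg a).+1). Qed.

Lemma ps_ordX d f j : ps_ord d f -> ps_ord (j * d) (f ^+ j).
Proof.
by move=> df; elim: j => [|j IH]; rewrite ?mul0n // mulSn exprS; apply: ps_ordM.
Qed.

Lemma ps_ord_mon w : ps_ord (mdeg w) (psmon w).
Proof. by move=> a; rewrite /=; case: eqP => // ->; rewrite ltnn. Qed.

Lemma pscoefM0 f g : pscoef (f * g) 0%MM = pscoef f 0%MM * pscoef g 0%MM.
Proof.
rewrite (@pscoefM_seq [:: (0%MM, 0%MM)]) ?big_seq1 // => -[b c].
rewrite inE xpair_eqE -!mdeg_eq0 -addn_eq0 -mdegD mdeg_eq0.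
by rewrite eq_sym.
Qed.

Lemma ps_ord1P f : ps_ord 1 f <-> pscoef f 0%MM = 0.
Proof.
split => [|f0 a]; first by apply; rewrite mdeg0.
by rewrite ltnS leqn0 mdeg_eq0 => /eqP ->.
Qed.

(** The coefficient at [a] is read at stage [(mdeg a).+1], after which it no longer changes if
    [F d.+1 - F d] has order at least [d]. *)
Definition pslim (F : nat -> powerseries m R) : powerseries m R :=
  PSeries (fun a => pscoef (F (mdeg a).+1) a).

Lemma pslimP F : (forall d, ps_ord d (F d.+1 - F d)) ->
  forall d, ps_ord d (pslim F - F d).
Proof.
move=> FF d a ad.
have H j : pscoef (F ((mdeg a).+1 + j)%N) a = pscoef (F (mdeg a).+1) a.
  elim: j => [|j <-]; rewrite ?addn0 // addnS; apply/eqP; rewrite -subr_eq0.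
  by rewrite -pscoefB FF // addSn ltnS leq_addr.
by rewrite pscoefB /= -(H (d - (mdeg a).+1)%N) subnKC // subrr.
Qed.

(* First-fit division by the monomials of exponents [e i]. *)
Lemma ps_decomp (t : nat) (e : 'I_t -> 'X_{1..m}) f :
    (forall a, pscoef f a != 0 -> exists i, (e i <= a)%MM) ->
  exists F : 'I_t -> powerseries m R, f = \sum_i psmon (e i) * F i /\
    forall i a, pscoef (F i) a = 0 \/ pscoef (F i) a = pscoef f (a + e i)%MM.
Proof.
move=> He.
pose sel (a : 'X_{1..m}) := [pick i | (e i <= a)%MM].
exists (fun i => PSeries (fun a =>
   if sel (a + e i)%MM == Some i then pscoef f (a + e i)%MM else 0)); split.
  apply: psP => a; rewrite pscoef_sum.
  rewrite (eq_bigr (fun i => if sel a == Some i then pscoef f a else 0)); last first.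
    move=> i _; rewrite pscoef_monM /=; case: ifP => eia; first by rewrite submK.
    by rewrite /sel; case: pickP => //= j eja; case: eqP => // -[ji];
      rewrite -ji eja in eia.
  rewrite /sel; case: pickP => [j _|no].
    by rewrite -big_mkcond (big_pred1 j) .
  rewrite big1 //; apply: contrapT => /eqP /He[i]; by rewrite no.
by move=> i a /=; case: ifP; [right|left].
Qed.

End PowerSeriesTheory.

Arguments ps_ord_ideal {m R} d.
Arguments psmon {m R} w.

(** Geometric series: [f] is its constant term times [1 - x] with [x] of order at least 1, and the
    partial sums of the powers of [x] converge. *)
Lemma ps_unit m (k : fieldType) (f : powerseries m k) :
  pscoef f 0%MM != 0 -> exists g, f * g = 1.
Proof.
move=> f0; pose c := pscoef f 0%MM.
pose x := 1 - psC m c^-1 * f.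
have ox : ps_ord 1 x.
  by apply/ps_ord1P; rewrite pscoefB pscoef1 eqxx pscoef_CM mulVf ?subrr.
pose F d := \sum_(i < d) x ^+ i.
have FF d : ps_ord d (F d.+1 - F d).
  rewrite /F big_ord_recr /= addrAC subrr add0r -{1}[d]muln1; exact: ps_ordX.
have E d : psC m c^-1 * f * F d = 1 - x ^+ d.
  have -> : psC m c^-1 * f = 1 - x by rewrite /x opprB addrC subrK.
  by rewrite -opprB mulNr -subrX1 opprB.
exists (psC m c^-1 * pslim F).
apply/eqP; rewrite -subr_eq0; apply/eqP; apply: ps_ord_eq0 => d.
have -> : f * (psC m c^-1 * pslim F) - 1 =
   (psC m c^-1 * f) * (pslim F - F d) - x ^+ d.
  rewrite mulrBr E; ring.
apply: (idealB (ps_ord_ideal _)).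
  by apply: (idealMl (ps_ord_ideal _)); apply: pslimP.
by rewrite -{1}[d]muln1; apply: ps_ordX.
Qed.

(** * Substitution into power series *)

Section Evaluation.
Variables (j m : nat) (k : comNzRingType) (u : 'I_j -> powerseries m k).
Hypothesis u1 : forall l, ps_ord 1 (u l).
Implicit Types (f g : powerseries j k) (p q : {mpoly k[j]}).

Let E p : powerseries m k := mmap (psC m (R := k)) u p.

Let mmap1_ord a : ps_ord (mdeg a) (mmap1 u a).
Proof.
rewrite /mmap1 mdegE; elim/big_rec2: _ => [|l x d _ dx]; first exact: ps_ord0.
by apply: ps_ordM => //; rewrite -[X in ps_ord X]muln1; apply: ps_ordX.
Qed.

Let E_ord d p : (forall b, (mdeg b < d)%N -> p@_b = 0) -> ps_ord d (E p).
Proof.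
move=> pd; rewrite /E /mmap; apply: (ideal_sum (ps_ord_ideal d)) => b _.
case: (ltnP (mdeg b) d) => [/pd ->|db].
  by rewrite rmorph0 mul0r; apply: (ideal0 (ps_ord_ideal d)).
by apply: (idealMl (ps_ord_ideal d)); apply: ps_ordW db _; apply: mmap1_ord.
Qed.

(** Monomials of degree [e] go to series of order at least [e], so the truncation in degree [mdeg a]
    determines the coefficient at [a]. The order condition is an argument so that morphism
    structures can be attached to [ps_eval u1]. *)
Definition ps_eval (_ : forall l, ps_ord 1 (u l)) f : powerseries m k :=
  PSeries (fun a => pscoef (E (pstrunc (mdeg a) f)) a).

Let ev := ps_eval u1.

(** Reduces every identity about [ev], modulo any given order, to one about [mmap] on
    polynomials. *)
Let ev_approx d f p : (forall b, (mdeg b <= d)%N -> p@_b = pscoef f b) ->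
  ps_ord d.+1 (ev f - E p).
Proof.
move=> pf a ad; rewrite pscoefB /= -pscoefB -rmorphB.
apply: (@E_ord (mdeg a).+1) => // b; rewrite ltnS => ba.
by rewrite mcoeffB pstruncE // pf ?subrr // (leq_trans ba).
Qed.

Let evT d f : ps_ord d.+1 (ev f - E (pstrunc d f)).
Proof. by apply: ev_approx => b; apply: pstruncE. Qed.

Let ev_eq f p : (forall b, p@_b = pscoef f b) -> ev f = E p.
Proof.
move=> pf; apply/eqP; rewrite -subr_eq0; apply/eqP; apply: ps_ord_eq0 => d.
by apply: (@ps_ordW _ _ d.+1) => //; apply: ev_approx => b _; apply: pf.
Qed.

Fact ps_eval_zmod : zmod_morphism ev.
Proof.
move=> f g; apply/eqP; rewrite -subr_eq0; apply/eqP; apply: ps_ord_eq0 => d.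
apply: (@ps_ordW _ _ d.+1) => //.
have -> : ev (f - g) - (ev f - ev g) =
   (ev (f - g) - E (pstrunc d f - pstrunc d g))
   - ((ev f - E (pstrunc d f)) - (ev g - E (pstrunc d g))).
  by rewrite [E (_ - _)]rmorphB; ring.
apply: (idealB (ps_ord_ideal _)).
  by apply: ev_approx => b bd; rewrite mcoeffB !pstruncE.
by apply: (idealB (ps_ord_ideal _)); apply: evT.
Qed.

Fact ps_eval_monoid : monoid_morphism ev.
Proof.
split.
  rewrite (@ev_eq _ 1); first by rewrite [E _]rmorph1.
  by move=> b; rewrite mcoeff1.
move=> f g; apply/eqP; rewrite -subr_eq0; apply/eqP; apply: ps_ord_eq0 => d.
apply: (@ps_ordW _ _ d.+1) => //.
have -> : ev (f * g) - ev f * ev g =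
   (ev (f * g) - E (pstrunc d f * pstrunc d g))
   - ((ev f - E (pstrunc d f)) * ev g + (ev g - E (pstrunc d g)) * E (pstrunc d f)).
  by rewrite [E (_ * _)]rmorphM; ring.
apply: (idealB (ps_ord_ideal _)).
  by apply: ev_approx => b bd; apply: psmulE bd => c; apply: pstruncE.
by apply: (idealD (ps_ord_ideal _)); apply: (idealMr (ps_ord_ideal _)); apply: evT.
Qed.

HB.instance Definition _ :=
  GRing.isZmodMorphism.Build (powerseries j k) (powerseries m k)
    (ps_eval u1) ps_eval_zmod.
HB.instance Definition _ :=
  GRing.isMonoidMorphism.Build (powerseries j k) (powerseries m k)
    (ps_eval u1) ps_eval_monoid.

Lemma ps_evalC c : ps_eval u1 (psC j c) = psC m c.
Proof.
rewrite [LHS](@ev_eq _ c%:MP) ?[E _]mmapC // => b.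
by rewrite mcoeffC /= eq_sym; case: eqP; rewrite ?mulr1n ?mulr0n ?mulr1 ?mulr0.
Qed.

Lemma ps_eval_var l : ps_eval u1 (psvar k l) = u l.
Proof.
rewrite [LHS](@ev_eq _ 'X_l) ?[E _]mmapX ?mmap1U // => b.
by rewrite mcoeffX eq_sym.
Qed.

End Evaluation.

Arguments ps_eval {j m k u} u1 f.

(* Iterating the relation [d x = \sum p e + \sum w d'] pushes [d] to arbitrarily
   high order while the coefficients of the [p t] converge. *)
Lemma ps_corec (m : nat) (k : comNzRingType) (X : Type) (j t : nat)
    (w : 'I_j -> powerseries m k) (p : 'I_t -> powerseries m k)
    (d : X -> powerseries m k) (e : X -> 'I_t -> powerseries m k)
    (nx : X -> 'I_j -> X) :
    (forall l, ps_ord 1 (w l)) ->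
    (forall x, d x = \sum_i p i * e x i + \sum_l w l * d (nx x l)) ->
  forall x, exists c, d x = \sum_i p i * c i.
Proof.
move=> w1 dE x.
(* [C D x] unfolds the relation [D] times and drops a remainder whose terms carry products of [D] of
   the [w l], hence have order at least [D]. *)
pose C := fix C D x i {struct D} : powerseries m k :=
  if D is D'.+1 then e x i + \sum_l w l * C D' (nx x l) i else 0.
have CC D : forall x i, ps_ord D (C D.+1 x i - C D x i).
  elim: D => [|D IH] y i; first exact: ps_ord0.
  have -> : C D.+2 y i - C D.+1 y i =
     \sum_l w l * (C D.+1 (nx y l) i - C D (nx y l) i).
    rewrite [C D.+2 y i]/= -/(C D.+1) [C D.+1 y i]/=.
    rewrite opprD addrACA subrr add0r -sumrB.
    by apply: eq_bigr => l _; rewrite mulrBr.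
  by apply: (ideal_sum (ps_ord_ideal _)) => l _; rewrite -add1n; apply: ps_ordM.
have dC D : forall x, ps_ord D (d x - \sum_i p i * C D x i).
  elim: D => [|D IH] y; first exact: ps_ord0.
  have -> : d y - \sum_i p i * C D.+1 y i =
     \sum_l w l * (d (nx y l) - \sum_i p i * C D (nx y l) i).
    rewrite {1}dE; under [X in _ - X]eq_bigr do rewrite /= mulrDr.
    rewrite big_split /= opprD addrACA subrr add0r.
    under [X in _ - X]eq_bigr do rewrite mulr_sumr.
    rewrite exchange_big -sumrB; apply: eq_bigr => l _.
    rewrite mulrBr mulr_sumr; congr (_ - _).
    by apply: eq_bigr => i _; rewrite mulrCA.
  by apply: (ideal_sum (ps_ord_ideal _)) => l _; rewrite -add1n; apply: ps_ordM.
exists (fun i => pslim (fun D => C D x i)).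
apply/eqP; rewrite -subr_eq0; apply/eqP; apply: ps_ord_eq0 => D.
set s := \sum_i _.
have -> : d x - s = (d x - \sum_i p i * C D x i)
   - \sum_i p i * (pslim (fun D => C D x i) - C D x i).
  have -> : \sum_i p i * (pslim (fun D => C D x i) - C D x i) =
      s - \sum_i p i * C D x i.
    by rewrite -sumrB; apply: eq_bigr => i _; rewrite mulrBr.
  by ring.
apply: (idealB (ps_ord_ideal _)) => //.
apply: (ideal_sum (ps_ord_ideal _)) => i _.
by apply: (idealMl (ps_ord_ideal _)); apply: (@pslimP _ _ (fun D => C D x i)).
Qed.

Lemma mdegB1 m (a : 'X_{1..m}) l : (0 < a l)%N -> (mdeg (a - U_(l))%MM).+1 = mdeg a.
Proof.
move=> al; have Ua : (U_(l) <= a)%MM by rewrite lep1mP -lt0n.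
by rewrite -{2}(submK Ua) mdegD mdeg1 addn1.
Qed.

Lemma mnm_gt0 m (a : 'X_{1..m}) : (0 < mdeg a)%N -> exists l, (0 < a l)%N.
Proof.
rewrite lt0n => a0; apply: contrapT => H; case/negP: a0; rewrite mdeg_eq0.
apply/eqP/mnmP => l; rewrite mnm0E; apply/eqP; rewrite -leqn0 leqNgt.
by apply/negP => al; apply: H; exists l.
Qed.

(** The coefficient at [b] is reached after [mdeg b] unfoldings: it sums [c] over the end points of
    all ways to peel the variables off [b] one by one. *)
Lemma ps_corec_series (k : comNzRingType) (X : Type) (j : nat) (c : X -> k)
    (nx : X -> 'I_j -> X) :
  exists F : X -> powerseries j k,
    forall x, F x = psC j (c x) + \sum_l psvar k l * F (nx x l).
Proof.
pose G := fix G D x (b : 'X_{1..j}) {struct D} := if D is D'.+1 then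
  \sum_(l | (0 < b l)%N) G D' (nx x l) (b - U_(l))%MM else c x.
exists (fun x => PSeries (fun b => G (mdeg b) x b)) => x.
apply: psP => b; rewrite pscoefD pscoef_sum [LHS]/=.
under [in RHS]eq_bigr do rewrite psvarE pscoef_monM lep1mP -lt0n.
rewrite -big_mkcond /=; case Eb: (mdeg b) => [|D].
  move/eqP: Eb; rewrite mdeg_eq0 => /eqP ->.
  by rewrite eqxx mulr1n big1 ?addr0 // => l; rewrite mnm0E.
have -> : (b == 0%MM) = false by rewrite -mdeg_eq0 Eb.
rewrite mulr0n add0r; apply: eq_bigr => l bl.
by move: (mdegB1 bl); rewrite Eb => -[->].
Qed.

(** * Division of series by variables and by monomials of a given degree *)

Section SeriesSplitting.
Variables (m : nat) (k : comNzRingType).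
Implicit Types f : powerseries m k.

(** The clause on coefficients makes the support of [F l] a shifted part of that of [f];
    [ps_eval_low] relies on it to control weights. *)
Lemma ps_split f : exists F : 'I_m -> powerseries m k,
  f = psC m (pscoef f 0%MM) + \sum_l psvar k l * F l /\
  forall l a, pscoef (F l) a = 0 \/ pscoef (F l) a = pscoef f (a + U_(l))%MM.
Proof.
pose f' := f - psC m (pscoef f 0%MM).
have f'E a : a != 0%MM -> pscoef f' a = pscoef f a.
  by move=> a0; rewrite pscoefB /= (negbTE a0) mulr0n subr0.
have [a|F [FE Fc]] := @ps_decomp m k m (fun l => U_(l)%MM) f'.
  case: (eqVneq a 0%MM) => [->|a0];
    first by rewrite pscoefB /= eqxx mulr1n subrr eqxx.
  have [|l al] := @mnm_gt0 _ a; first by rewrite lt0n mdeg_eq0.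
  by exists l; rewrite lep1mP -lt0n.
exists F; split; first by rewrite -FE addrC subrK.
move=> l a; case: (Fc l a) => ->; [by left | right; apply: f'E].
by rewrite -mdeg_eq0 mdegD mdeg1 addn1.
Qed.

Lemma mnm_below (a : 'X_{1..m}) r :
  (r <= mdeg a)%N -> exists2 b, mdeg b = r & (b <= a)%MM.
Proof.
move=> ra; have [d] := ubnP (mdeg a); elim: d a ra => // d IH a ra ad.
case: (ltngtP r (mdeg a)) ra => // [ra|->] _; last by exists a; rewrite ?lepm_refl.
have [|l al] := @mnm_gt0 _ a; first exact: leq_ltn_trans (leq0n r) ra.
have da := mdegB1 al.
have [||b br ba] := IH (a - U_(l))%MM.
- by rewrite -ltnS da.
- by rewrite da -ltnS.
by exists b => //; apply: lepm_trans ba (lem_subr _ _).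
Qed.

Lemma ps_ord_decomp r : exists t (e : 'I_t -> 'X_{1..m}),
  (forall i, mdeg (e i) = r) /\
  forall f, ps_ord r f -> exists F : 'I_t -> powerseries m k,
     f = \sum_i psmon (e i) * F i.
Proof.
pose A : {set 'X_{1..m < r.+1}} := [set a : 'X_{1..m < r.+1} | mdeg a == r]%SET.
exists #|A|, (fun i => bmnm (enum_val i)); split => [i|f fr].
  by have := enum_valP i; rewrite inE => /eqP.
have [a fa|F [FE _]] := @ps_decomp m k #|A| (fun i => bmnm (enum_val i)) f;
  last by exists F.
have ra : (r <= mdeg a)%N by rewrite leqNgt; apply/negP => /fr /eqP; apply/negP.
have [b br ba] := mnm_below ra.
have hb : (mdeg b < r.+1)%N by rewrite br.
have bA : BMultinom hb \in A by rewrite inE /= br.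
by exists (enum_rank_in bA (BMultinom hb)); rewrite enum_rankK_in.
Qed.

End SeriesSplitting.

(** * Dimension of power series rings *)

Section ParamSystems.
Variables (m : nat) (k : fieldType).
Notation Q := (powerseries m k).

Definition ideal_plus (P : set Q) j (u : 'I_j -> Q) : set Q :=
  [set f | exists p c, P p /\ f = p + \sum_l u l * c l].

Lemma ideal_plus_ideal (P : set Q) j (u : 'I_j -> Q) :
  is_ideal P -> is_ideal (ideal_plus P u).
Proof.
move=> idP; split.
- exists 0, (fun=> 0); split; first exact: ideal0.
  by rewrite big1 ?addr0 // => l _; rewrite mulr0.
- move=> f g [p [c [Pp ->]]] [q [d [Pq ->]]].
  exists (p + q), (fun l => c l + d l); split; first exact: idealD.
  by under [in RHS]eq_bigr do rewrite mulrDr; rewrite big_split /= addrACA.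
- move=> a f [p [c [Pp ->]]]; exists (a * p), (fun l => a * c l).
  split; first exact: idealMl.
  by rewrite mulrDr mulr_sumr; under eq_bigr do rewrite mulrCA.
Qed.

Lemma ideal_plus_sub (P : set Q) j (u : 'I_j -> Q) p : P p -> ideal_plus P u p.
Proof.
by move=> Pp; exists p, (fun=> 0); split; rewrite // big1 ?addr0 // => l _;
  rewrite mulr0.
Qed.

Lemma ideal_plus_gen (P : set Q) j (u : 'I_j -> Q) l : is_ideal P ->
    ideal_plus P u (u l).
Proof.
move=> idP; exists 0, (fun i => (i == l)%:R); split; first exact: ideal0.
rewrite add0r (bigD1 l) //= eqxx mulr1 big1 ?addr0 // => i /negbTE ->.
by rewrite mulr0.
Qed.

(* [j] elements of the maximal ideal generate, modulo [P], an ideal that is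
   primary to the maximal ideal; in particular [Q / P] has dimension at most [j]. *)
Definition has_params j (P : set Q) : Prop :=
  exists u : 'I_j -> Q, (forall l, ps_ord 1 (u l)) /\
  exists r, forall f, ps_ord r f -> ideal_plus P u f.

Section Integrality.
Variables (P : set Q) (j : nat) (u : 'I_j -> Q) (r : nat).
Hypotheses (idP : is_ideal P) (u1 : forall l, ps_ord 1 (u l)).
Hypothesis ur : forall f, ps_ord r f -> ideal_plus P u f.

Let B := 'X_{1..m < r.+1}.

(* Only the finitely many components in [P] of the monomials of degree [r.+1] are
   used, so that [P] need not be known to be finitely generated. *)
Lemma spans_mod : exists F : Q -> B -> powerseries j k,
  forall s, P (s - \sum_(b : B) ps_eval u1 (F s b) * psmon b).
Proof.
have [t [e [eM eD]]] := ps_ord_decomp m k r.+1.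
have mon_dec i : ideal_plus P u (psmon (e i)).
  by apply: ur; apply: (@ps_ordW _ _ r.+1) => //; rewrite -(eM i); apply: ps_ord_mon.
have [p0 pH] := choice mon_dec; have [c0 cH] := choice pH.
pose low s : Q := \sum_(b : B) psC m (pscoef s b) * psmon b.
have lowE s a : (mdeg a < r.+1)%N -> pscoef (low s) a = pscoef s a.
  move=> ar; rewrite /low pscoef_sum (bigD1 (BMultinom ar)) //.
  rewrite pscoef_CM big1 => [|b bn]; first by rewrite /= eqxx mulr1 addr0.
  rewrite pscoef_CM /=; case: eqP => [ab|_]; last by rewrite mulr0.
  by case/eqP: bn; apply: val_inj.
have sD s : exists F : 'I_t -> Q, s = low s + \sum_i psmon (e i) * F i.
  have [a ar|F FE] := eD (s - low s); first by rewrite pscoefB lowE ?subrr.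
  by exists F; rewrite -FE addrC subrK.
have [G GE] := choice sD.
(* Rewriting each monomial of degree [r.+1] modulo [P] turns [s] into its low part, an element of
   [P], and a combination of the [u l] whose coefficients [nx s l] can be treated in the same
   way. *)
pose nx s l := \sum_i c0 i l * G s i.
have sE s : s = low s + \sum_i p0 i * G s i + \sum_l u l * nx s l.
  rewrite {1}(GE s) -addrA; congr (_ + _).
  rewrite /nx; under [X in _ + X]eq_bigr do rewrite mulr_sumr.
  rewrite exchange_big -big_split /=; apply: eq_bigr => i _.
  have [_ {1}->] := cH i; rewrite mulrDl mulr_suml; congr (_ + _).
  by apply: eq_bigr => l _; rewrite mulrA.
clearbody nx.
have Fb (b : B) : exists F : Q -> powerseries j k,
    forall s, F s = psC j (pscoef s b) + \sum_l psvar k l * F (nx s l).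
  exact: ps_corec_series.
have [F0 FE] := choice Fb.
exists (fun s b => F0 b s) => s0.
pose d s := s - \sum_(b : B) ps_eval u1 (F0 b s) * psmon b.
have dE s : d s = \sum_i p0 i * G s i + \sum_l u l * d (nx s l).
  rewrite /d; under eq_bigr do rewrite FE rmorphD rmorph_sum /= ps_evalC mulrDl.
  rewrite big_split /= -/(low s) {1}(sE s).
  under [X in _ = _ + X]eq_bigr do rewrite mulrBr mulr_sumr.
  rewrite sumrB exchange_big /=.
  set X := \sum_(b : B) _; set Y := \sum_(b : B) _.
  suff -> : X = Y by ring.
  apply: eq_bigr => b _; rewrite mulr_suml; apply: eq_bigr => l _.
  by rewrite rmorphM /= ps_eval_var mulrA.
(* The error [d s0] becomes a combination of the finitely many [p0 i], which lie in [P]. *)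
have [c] := ps_corec u1 dE s0; rewrite /d => ->.
by apply: (ideal_sum idP) => i _; apply: (idealMr idP); case: (cH i).
Qed.

(** Cayley-Hamilton: [M] is a matrix of multiplication by [z] on the monomials that span [Q] modulo
    [P], and [chi] is its characteristic polynomial. *)
Lemma integral_mod z : exists2 chi : {poly powerseries j k},
  chi \is monic & P (map_poly (ps_eval u1) chi).[z].
Proof.
have [F FE] := spans_mod.
pose q := #|{: B}|.
pose b (i : 'I_q) : Q := psmon (bmnm (enum_val i)).
pose M : 'M[powerseries j k]_q :=
  \matrix_(i, i') F (z * b i) (enum_val i').
exists (char_poly M); first exact: char_poly_monic.
pose phi := horner_eval z.
pose A := map_mx phi (map_mx (map_poly (ps_eval u1)) (char_poly_mx M)).
have AE i i' : A i i' = z *+ (i == i') - ps_eval u1 (M i i').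
  rewrite !mxE rmorphB rmorphMn /= map_polyX map_polyC /phi.
  by rewrite /horner_eval hornerD hornerN hornerMn hornerX hornerC.
have Ab i : P (\sum_i' A i i' * b i').
  under eq_bigr do rewrite AE mulrBl.
  rewrite sumrB (bigD1 i) //= eqxx mulr1n [X in _ + X - _]big1 ?addr0; last first.
    by move=> i' /negbTE; rewrite eq_sym => ->; rewrite mulr0n mul0r.
  have := FE (z * b i); rewrite (reindex_onto (@enum_val _ _) enum_rank) /=;
    last first.
    by move=> x _; rewrite enum_rankK.
  under eq_bigl do rewrite enum_valK eqxx.
  by under [X in _ -> P (_ - X)]eq_bigr do rewrite mxE.
have detA : \det A = (map_poly (ps_eval u1) (char_poly M)).[z].
  by rewrite /A !det_map_mx.
rewrite -detA.
have h0 : (mdeg (0%MM : 'X_{1..m}) < r.+1)%N by rewrite mdeg0.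
pose i0 := enum_rank (BMultinom h0).
have b0 : b i0 = 1 by rewrite /b enum_rankK psmon0.
(* The adjugate turns the relations [Ab] into [\det A * b i] in [P]; the row [i0] belongs to the
   generator 1. *)
have -> : \det A = \sum_i \adj A i0 i * (\sum_i' A i i' * b i').
  under eq_bigr do rewrite mulr_sumr.
  rewrite exchange_big /=.
  have adjE i' : \sum_i \adj A i0 i * (A i i' * b i') = (\det A *+ (i0 == i')) * b i'.
    have := congr1 (fun X : 'M_q => X i0 i') (mul_adj_mx A).
    rewrite /= !mxE => <-; rewrite mulr_suml; apply: eq_bigr => i _.
    by rewrite mulrA.
  under eq_bigr do rewrite adjE.
  rewrite (bigD1 i0) //= eqxx mulr1n b0 mulr1 big1 ?addr0 // => i'.
  by rewrite eq_sym => /negbTE ->; rewrite mulr0n mul0r.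
by apply: (ideal_sum idP) => i _; apply: (idealMl idP).
Qed.

(** In an equation for [z] modulo [P], factors [z] are cancelled until the constant coefficient [c]
    has image outside [P]; this image lies in [P'] because [z] does. The induction only keeps the
    image of the leading coefficient outside [P], since [chi] need not stay monic for the
    argument. *)
Lemma params_series (P' : set Q) z : is_prime_ideal P -> is_ideal P' ->
    (forall x, P x -> P' x) -> P' z -> ~ P z ->
  exists g, P' (ps_eval u1 g) /\ ~ P (ps_eval u1 g).
Proof.
move=> prP idP' PP' P'z nPz.
have [chi chi_monic] := integral_mod z.
have [q] := ubnP (size chi).
have : ~ P (ps_eval u1 (lead_coef chi)).
  by rewrite (monicP chi_monic) rmorph1; case: prP.
elim: q chi {chi_monic} => // q IH chi.
elim/poly_ind: chi => [|chi c _];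
  first by rewrite lead_coef0 rmorph0 => /(_ (ideal0 idP)).
case: (EM (P (ps_eval u1 c))) => [Pc|nPc] lead_chi size_chi.
  rewrite rmorphD rmorphM /= map_polyX map_polyC hornerMXaddC => Pchi.
  have [chi0|chi0] := eqVneq chi 0.
    by case: lead_chi; rewrite chi0 mul0r add0r lead_coefC.
  have : P ((map_poly (ps_eval u1) chi).[z] * z).
    by have := idealB idP Pchi Pc; rewrite addrK.
  have [_ _ PM] := prP => /PM[|//]; apply: IH.
    move: lead_chi; rewrite lead_coefDl ?lead_coefMX //.
    by rewrite size_mulX // size_polyC ltnS; case: (c == 0);
      rewrite //= lt0n size_poly_eq0.
  move: size_chi; rewrite -cons_poly_def size_cons_poly nil_poly (negbTE chi0) /=.
  by rewrite ltnS.
rewrite rmorphD rmorphM /= map_polyX map_polyC hornerMXaddC => Pchi.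
exists c; split => //.
have : P' ((map_poly (ps_eval u1) chi).[z] * z) by apply: idealMl.
by move/(idealB idP' (PP' _ Pchi)); rewrite addrAC subrr add0r.
Qed.

End Integrality.

End ParamSystems.

(** * Normalization by the substitution of powers of one parameter *)

Section Normalization.
Variables (j m : nat) (k : fieldType).
Notation B := (powerseries j k).
Notation Q := (powerseries m k).

(** Splitting off one variable gives [u l * F(u) - w l * F(w) = (u l - w l) * F(u) + w l * (F(u) -
    F(w))], a relation that [ps_corec] iterates. *)
Lemma ps_eval_diff (u w : 'I_j -> Q) (u1 : forall l, ps_ord 1 (u l))
    (w1 : forall l, ps_ord 1 (w l)) (g : B) :
  exists c, ps_eval u1 g - ps_eval w1 g = \sum_l (u l - w l) * c l.
Proof.
have [nx nxE] := choice (fun f : B => @ps_split j k f).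
pose d (f : B) := ps_eval u1 f - ps_eval w1 f.
apply: (@ps_corec m k B j j w (fun l => u l - w l) d
          (fun f l => ps_eval u1 (nx f l)) nx w1).
move=> f; rewrite /d; have [fE _] := nxE f.
rewrite {1 2}fE !rmorphD !rmorph_sum /= !ps_evalC -big_split opprD addrACA subrr
  add0r.
rewrite -sumrB; apply: eq_bigr => l _.
by rewrite !rmorphM /= !ps_eval_var; ring.
Qed.

(** The exponent of [t] in the image of the monomial [b] when each variable [l] is sent to
    [t ^+ N l]. *)
Definition mnm_wt (N : 'I_j -> nat) (b : 'X_{1..j}) : nat := (\sum_l N l * b l)%N.

Lemma mnm_wt0 N : mnm_wt N 0%MM = 0%N.
Proof. by rewrite /mnm_wt big1 // => l _; rewrite mnm0E muln0. Qed.

Lemma mnm_wtD1 N b l : mnm_wt N (b + U_(l))%MM = (mnm_wt N b + N l)%N.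
Proof.
rewrite /mnm_wt; under eq_bigr do rewrite mnmDE mnm1E mulnDr.
rewrite big_split /=; congr addn; rewrite (bigD1 l) //= eqxx muln1 big1 ?addn0 //.
by move=> i /negbTE; rewrite eq_sym => ->; rewrite muln0.
Qed.

Lemma ps_eval_low (t : Q) (N : 'I_j ->
    nat) (w1 : forall l, ps_ord 1 (t ^+ N l)) d (h : B) :
    (forall l, 0 < N l)%N ->
    (forall b, pscoef h b != 0 -> (d <= mnm_wt N b)%N) ->
  exists c, ps_eval w1 h = t ^+ d * c.
Proof.
move=> N0; have [e] := ubnP d; elim: e d h => // e IH d h de hd.
have [d0|dn0] := eqVneq d 0%N; first by exists (ps_eval w1 h); rewrite d0 mul1r.
have [F [hE FE]] := ps_split h.
have h0 : pscoef h 0%MM = 0.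
  apply/eqP; apply: contrapT => /negP /hd; rewrite mnm_wt0 leqn0.
  exact/negP.
have IHl l : exists c, ps_eval w1 (F l) = t ^+ (d - N l) * c.
  apply: IH; first by have := N0 l; lia.
  move=> b Fb; rewrite leq_subLR addnC -mnm_wtD1; apply: hd.
  by case: (FE l b) => [F0|<- //]; rewrite F0 eqxx in Fb.
have [c cE] := choice IHl.
(* By truncated subtraction the surplus [N l + (d - N l) - d] is nonzero only when [N l] exceeds
   [d]. *)
exists (\sum_l t ^+ (N l + (d - N l) - d) * c l).
rewrite {1}hE h0 rmorph0 add0r rmorph_sum mulr_sumr; apply: eq_bigr => l _.
rewrite rmorphM /= ps_eval_var cE !mulrA -!exprD; congr (_ ^+ _ * _).
lia.
Qed.

End Normalization.

(** The coordinates are minimised one after the other, each among the elements of [A] that agree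
    with the minimum found so far. *)
Lemma lex_min (j : nat) (A : 'X_{1..j} -> Prop) a0 : A a0 ->
  exists2 a, A a & forall b, A b -> b != a ->
    exists i, (a i < b i)%N /\ forall i' : 'I_j, (i' < i)%N -> b i' = a i'.
Proof.
move=> Aa0.
suff H l : (l <= j)%N -> exists2 a, A a & forall b, A b ->
    (exists i, (a i < b i)%N /\ forall i' : 'I_j, (i' < i)%N -> b i' = a i') \/
    (forall i : 'I_j, (i < l)%N -> b i = a i).
  have [a Aa aM] := H j (leqnn j); exists a => // b Ab nba.
  case: (aM b Ab) => // ab; case/eqP: nba; apply/mnmP => i; exact: ab.
elim: l => [_|l IH lj]; first by exists a0 => // b Ab; right.
have [a Aa aM] := IH (ltnW lj).
pose L := Ordinal lj.
pose V v := `[< exists2 b, A b /\ (forall i : 'I_j, (i < l)%N ->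
  b i = a i) & b L = v >].
have exV : exists v, V v by exists (a L); apply/asboolP; exists a.
case: (ex_minnP exV) => v /asboolP[c [Ac ca] cv] vmin.
exists c => // b Ab.
have [[i [il ai bi]]|ba] : (exists i : 'I_j, [/\ (i < l)%N, (a i < b i)%N &
     forall i' : 'I_j, (i' < i)%N -> b i' = a i']) \/
     (forall i : 'I_j, (i < l)%N -> b i = a i).
  case: (aM b Ab) => [[i [ai bi]]|]; last by right.
  case: (ltnP i l) => il; first by left; exists i.
  by right => i' i'l; apply: bi; apply: leq_trans il.
  left; exists i; rewrite ca //; split=> // i' i'i.
  by rewrite bi // ca // (ltn_trans i'i).
have : V (b L) by apply/asboolP; exists b.
move/vmin; rewrite leq_eqVlt => /orP[/eqP vb|vb].
  right => i; rewrite ltnS leq_eqVlt => /orP[/eqP il|il].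
    by have -> : i = L by [apply: val_inj]; rewrite cv.
  by rewrite ba // ca.
left; exists L; rewrite cv; split=> // i il; by rewrite ba // ca.
Qed.

(** With [a] lexicographically least in the support, the weights are powers of a base [D] larger
    than [mdeg a]. At the first difference [b] exceeds [a] by at least 1, which outweighs all later
    coordinates of [a]. The last weight is 1 so that the last parameter is its own substitute. *)
Lemma weight_min (j : nat) (k : fieldType) (g : powerseries j.+1 k) : g != 0 ->
  exists N : 'I_j.+1 -> nat, exists a, [/\ (forall l, 0 < N l)%N, N ord_max = 1%N,
    pscoef g a != 0 &
    forall b, pscoef g b != 0 -> b != a -> (mnm_wt N a < mnm_wt N b)%N].
Proof.
move=> g0.
have [a0 ga0] : exists a, pscoef g a != 0.
  apply: contrapT => H; case/eqP: g0; apply: psP => a; apply/eqP.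
  by apply: contrapT => /negP ga; apply: H; exists a.
have [a ga amin] := @lex_min _ (fun b => pscoef g b != 0) _ ga0.
pose D := (mdeg a).+1.
exists (fun l => D ^ (j - l))%N, a; split=> // [l||b gb ba].
- by rewrite expn_gt0.
- by rewrite subnn.
have [i [ai bi]] := amin b gb ba.
rewrite /mnm_wt.
have lowE : (\sum_(l < j.+1 | l < i) D ^ (j - l) * b l =
             \sum_(l < j.+1 | l < i) D ^ (j - l) * a l)%N.
  by apply: eq_bigr => l li; rewrite bi.
have highE : (\sum_(l < j.+1 | (~~ (l < i)) && (l != i)) D ^ (j - l) * a l < D ^
  (j - i))%N.
  case: (ltnP i j) => [ij|ji]; last first.
    rewrite big1 ?expn_gt0 // => l /andP[]; rewrite -leqNgt => il nli.
    by case/eqP: nli; apply: val_inj => /=; have := ltn_ord l; have := ltn_ord i; lia.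
  apply: (@leq_ltn_trans (D ^ (j - i.+1) * mdeg a)%N); last first.
    by rewrite -(@subnSK i j) // expnSr ltn_pmul2l ?expn_gt0.
  rewrite mdegE big_distrr /= [leqRHS](bigID (fun l : 'I_j.+1 =>
    ~~ (l < i)%N && (l != i))) /=.
  apply: leq_trans (leq_addr _ _); apply: leq_sum => l /andP[].
  rewrite -leqNgt leq_eqVlt => /orP[/eqP il|il]; first by rewrite (val_inj il) eqxx.
  by move=> _; rewrite leq_mul2r leq_pexp2l ?orbT //; lia.
rewrite [ltnLHS](bigID (fun l : 'I_j.+1 => l < i)%N) /=.
rewrite [ltnRHS](bigID (fun l : 'I_j.+1 => l < i)%N) /= lowE ltn_add2l.
rewrite [ltnLHS](bigD1 i) ?ltnn //= [ltnRHS](bigD1 i) ?ltnn //=.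
apply: leq_trans (leq_addr _ _).
apply: (@leq_trans (D ^ (j - i) * a i + D ^ (j - i))%N); first by rewrite ltn_add2l.
by rewrite -mulnSr leq_mul2l ai orbT.
Qed.

Lemma radical_ideal (R : comNzRingType) (J : set R) : is_ideal J ->
    is_ideal (radical J).
Proof.
move=> idJ; split.
- by exists 1%N; rewrite expr1; apply: ideal0.
- move=> x y [a Ja] [b Jb]; exists (a + b)%N.
  rewrite exprDn; apply: (ideal_sum idJ) => i _; rewrite -mulr_natr;
    apply: (idealMr idJ).
  case: (leqP b i) => bi; first by rewrite -(subnK bi) exprD !mulrA; apply: idealMl.
  have ai : (a <= a + b - i)%N by lia.
  by rewrite -(subnK ai) exprD -mulrA mulrCA; apply: idealMr.
- by move=> a x [b Jb]; exists b; rewrite exprMn; apply: idealMl.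
Qed.

(** * Bound on chains of primes by the number of parameters *)

Section Dimension.
Variables (m : nat) (k : fieldType).
Notation Q := (powerseries m k).

(** Pigeonhole: an exponent of degree above [m * N] has a coordinate at least [N]. *)
Lemma radical_vars_ord (J : set Q) : is_ideal J ->
  (forall i, radical J (psvar k i)) -> exists r, forall f, ps_ord r f -> J f.
Proof.
move=> idJ /choice[e eJ].
pose N := \max_i e i.
exists (m * N).+1%N => f fr.
have [a fa|F [-> _]] := @ps_decomp m k m (fun i => U_(i) *+ N)%MM f; last first.
  apply: (ideal_sum idJ) => i _; apply: (idealMr idJ).
  rewrite -psmonX -psvarE -(subnK (leq_bigmax i : (e i <= N)%N)) exprD.
  exact: idealMl.
have [i Ni] : exists i, (N <= a i)%N.
  apply: contrapT => H; case/eqP: fa; apply: fr; rewrite ltnS mdegE.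
  rewrite -[X in (_ <= X * _)%N]card_ord -sum_nat_const; apply: leq_sum => i _.
  by rewrite leqNgt; apply/negP => /ltnW Ni; apply: H; exists i.
exists i; apply/mnm_lepP => i'; rewrite mulmnE mnm1E.
by case: eqP => [<-|_]; rewrite ?mul1n ?mul0n.
Qed.

(** A nonzero relation [g(u)] in [P'] saves one parameter: modulo [P'] and the differences
    [u l - t ^+ N l], it becomes a power of [t] times a unit, so [t] and then all [u l] are
    nilpotent. *)
Lemma params_step (P P' : set Q) j : is_prime_ideal P -> is_prime_ideal P' ->
  (P `<` P')%classic -> has_params j.+1 P -> has_params j P'.
Proof.
move=> prP prP' [PP' nP'P] [u [u1 [r ur]]].
have [z P'z nPz] : exists2 z, P' z & ~ P z.
  by apply: contrapT => H; apply: nP'P => z P'z; apply: contrapT => nPz;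
    apply: H; exists z.
have [idP _ _] := prP; have [idP' P'1 P'M] := prP'.
have [g [P'g nPg]] := params_series idP u1 ur prP idP' PP' P'z nPz.
have [|N [a [N0 Nmax ga amin]]] := @weight_min j k g.
  by apply/eqP => g0; apply: nPg; rewrite g0 rmorph0; apply: ideal0.
pose t := u ord_max.
have w1 l : ps_ord 1 (t ^+ N l).
  by apply: (ps_ordW (N0 l)); rewrite -[X in ps_ord X]muln1; apply/ps_ordX/u1.
pose v (l : 'I_j) := u (widen_ord (leqnSn j) l) - t ^+ N (widen_ord (leqnSn j) l).
exists v; split.
  by move=> l; apply: (idealB (ps_ord_ideal 1)).
set J := ideal_plus P' v.
have idJ : is_ideal J by apply: ideal_plus_ideal.
have uJ l : J (u l - t ^+ N l).
  case: (unliftP ord_max l) => [l' ->|->]; last first.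
    by rewrite Nmax expr1 subrr; apply: ideal0.
  have -> : lift ord_max l' = widen_ord (leqnSn j) l' by apply: val_inj;
    apply: lift_max.
  exact: ideal_plus_gen.
(* [g(u)] lies in [P'], and replacing [u l] by [t ^+ N l] changes it by an element of [J]. *)
have Jw : J (ps_eval w1 g).
  have [c cE] := ps_eval_diff u1 w1 g.
  have -> : ps_eval w1 g = ps_eval u1 g - (ps_eval u1 g - ps_eval w1 g) by ring.
  apply: (idealB idJ); first exact: ideal_plus_sub.
  by rewrite cE; apply: (ideal_sum idJ) => l _; apply: (idealMr idJ).
(* [h] is the only term of [g] of least weight; the others contribute a further factor [t], so the
   cofactor of [t ^+ mnm_wt N a] has nonzero constant term. *)
have Jt : radical J t.
  exists (mnm_wt N a).
  pose h : powerseries j.+1 k := psC _ (pscoef g a) * psmon a.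
  have hE b : pscoef h b = if b == a then pscoef g a else 0.
    by rewrite pscoef_CM /=; case: eqP; rewrite ?mulr1 ?mulr0.
  have [b hb|c0 c0E] := @ps_eval_low _ m k t N w1 (mnm_wt N a).+1 (g - h) N0.
    apply: amin; last by apply: contraNneq hb => ->; rewrite pscoefB hE eqxx subrr.
    move: hb; rewrite pscoefB hE; case: (eqVneq b a) => [->|_]; last by rewrite subr0.
    by rewrite subrr eqxx.
  have evmon b : ps_eval w1 (psmon b) = t ^+ mnm_wt N b.
    have [e] := ubnP (mdeg b); elim: e b => // e IH b be.
    have [b0|b0] := posnP (mdeg b).
      move/eqP: b0; rewrite mdeg_eq0 => /eqP ->.
      by rewrite mnm_wt0 psmon0 rmorph1.
    have [l bl] := mnm_gt0 b0.
    have Ub : (U_(l) <= b)%MM by rewrite lep1mP -lt0n.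
    rewrite -(submK Ub) -psmonM -psvarE rmorphM /= ps_eval_var IH; last first.
      by rewrite mdegB1.
    by rewrite mnm_wtD1 exprD.
  have gE : ps_eval w1 g = t ^+ mnm_wt N a * (psC m (pscoef g a) + t * c0).
    rewrite -[g in LHS](subrK h) rmorphD /= c0E /h rmorphM /= ps_evalC evmon exprSr.
    by ring.
  have [|y yE] := @ps_unit _ _ (psC m (pscoef g a) + t * c0).
    by rewrite pscoefD pscoefM0 ((ps_ord1P t).1 (u1 _)) //= mul0r addr0 eqxx mulr1n.
  by rewrite -[_ ^+ _]mulr1 -yE mulrA -gE; apply: (idealMr idJ).
have idrJ := radical_ideal idJ.
have subJ x : J x -> radical J x by exists 1%N; rewrite expr1.
have Ju l : radical J (u l).
  rewrite -(subrK (t ^+ N l) (u l)); apply: (idealD idrJ); first exact: subJ.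
  by rewrite -(prednK (N0 l)) exprS; apply: (idealMr idrJ).
apply: (radical_vars_ord idJ) => i.
suff [e Je] : radical (radical J) (psvar k i).
  by have [e' Je'] := Je; exists (e * e')%N; rewrite exprM.
(* The [r]-th power of a variable has order at least [r], hence is an element of [P] plus a
   combination of the [u l]. *)
exists r.
have [|p [c [Pp ->]]] := ur (psvar k i ^+ r).
  rewrite -[X in ps_ord X]muln1; apply: ps_ordX; rewrite -(mdeg1 i);
    exact: ps_ord_mon.
apply: (idealD idrJ); first by apply/subJ/ideal_plus_sub/PP'.
by apply: (ideal_sum idrJ) => l _; apply: (idealMr idrJ).
Qed.

(** Without parameters every series of order at least [r] lies in [P], so the maximal ideal is
    nilpotent modulo [P] and [P] contains it. *)
Lemma params0_max (P P' : set Q) : is_prime_ideal P -> is_prime_ideal P' ->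
  (P `<` P')%classic -> ~ has_params 0 P.
Proof.
move=> prP [idP' P'1 _] [PP' nP'P] [u [_ [r ur]]].
apply: nP'P => z P'z; case: (EM (pscoef z 0%MM = 0)) => [z0|/eqP /ps_unit[y zy]].
  apply: (prime_idealX (m := r) prP).
  have [|p [c [Pp ->]]] := ur (z ^+ r); last by rewrite big_ord0 addr0.
  by rewrite -[X in ps_ord X]muln1; apply/ps_ordX/ps_ord1P.
by case: P'1; rewrite -zy; apply: (idealMr idP').
Qed.

Lemma params_chain j h (c : nat -> set Q) :
    (forall i, (i <= h)%N -> is_prime_ideal (c i)) ->
    (forall i, (i < h)%N -> (c i `<` c i.+1)%classic) ->
  has_params j (c 0%N) -> (h <= j)%N.
Proof.
elim: j h c => [|j IH] [|h] c prc cS par //.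
  by case: (params0_max (prc 0%N isT) (prc 1%N isT) (cS 0%N isT)).
apply: (IH h (fun i => c i.+1)) => [i ih|i ih|]; [exact: prc|exact: cS|].
exact: params_step (prc 0%N isT) (prc 1%N isT) (cS 0%N isT) par.
Qed.

End Dimension.

(** * Leading exponents and lengths *)

Lemma nat_max_eq (A : set nat) d :
  A d -> (forall n, A n -> (n <= d)%N) -> nat_max A = d.
Proof.
move=> Ad Amax; apply: xget_unique; first by [].
by move=> e [Ae emax]; apply/eqP; rewrite eqn_leq Amax // emax.
Qed.

Definition outside m r (M : set 'X_{1..m}) : {set 'X_{1..m < r}} :=
  [set w : 'X_{1..m < r} | `[< ~ M (bmnm w) >]]%SET.

Lemma outsideP m r (M : set 'X_{1..m}) (w : 'X_{1..m < r}) :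
  reflect (~ M (bmnm w)) (w \in outside r M).
Proof. by rewrite inE; apply: asboolP. Qed.

Section LeadingExponents.
Variables (m : nat) (k : fieldType).
Notation Q := (powerseries m k).
Implicit Types (f g : Q) (J : set Q) (v w : 'X_{1..m}).

Definition above w f : Prop := forall v, (v < w)%O -> pscoef f v = 0.

(** The leading exponent of a series is its smallest one, for a monomial order that refines the
    degree. *)
Definition lead J : set 'X_{1..m} :=
  [set w | exists f, [/\ J f, pscoef f w != 0 & above w f]].

(** Since the order is compatible with addition, [(v, w)] is the only decomposition of [v + w] that
    can contribute to the product. *)
Lemma above_lead v w f g : above v f -> above w g ->
  above (v + w)%MM (f * g) /\
  pscoef (f * g) (v + w)%MM = pscoef f v * pscoef g w.
Proof.
move=> fv gw; split => [a avw|].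
  rewrite pscoefM big1 // => b /eqP ab.
  case: (ltP (bmnm b.1) v) => [/fv ->|vb]; first by rewrite mul0r.
  rewrite (gw b.2) ?mulr0 // ltNge; apply/negP => wb.
  by move: avw; rewrite {1}ab ltNge lem_add.
have hv : (mdeg v < (mdeg (v + w)%MM).+1)%N by rewrite mdegD ltnS leq_addr.
have hw : (mdeg w < (mdeg (v + w)%MM).+1)%N by rewrite mdegD ltnS leq_addl.
rewrite pscoefM (bigD1 (BMultinom hv, BMultinom hw)) //= big1 ?addr0 //.
move=> -[b1 b2] /andP[/eqP /= vwb nb].
case: (ltgtP (bmnm b1) v) => [/fv ->|vb|vb]; first by rewrite mul0r.
  rewrite (gw b2) ?mulr0 // ltNge; apply/negP => wb.
  by have := ltmc_le_add vb wb; rewrite -[X in (_ < X)%O]vwb ltxx.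
case/eqP: nb; congr (_, _); apply: val_inj => //=.
by apply: (@addmI _ v); rewrite [RHS]vwb vb.
Qed.

Lemma le0mc v : ((0%MM : 'X_{1..m}) <= v)%O.
Proof. by rewrite -[v]addm0 lemc_addl. Qed.

Lemma above0 f : above 0%MM f.
Proof. by move=> v; rewrite ltNge le0mc. Qed.

Lemma above_ideal w : is_ideal (above w).
Proof.
split => //.
- by move=> f g fw gw v vw; rewrite pscoefD fw ?gw ?addr0.
- by move=> a f fw; rewrite -[w]add0m; apply: (above_lead (above0 a) fw).1.
Qed.

Lemma above_mon w : above w (psmon w).
Proof. by move=> v /=; case: eqP => // ->; rewrite ltxx. Qed.

Lemma leadM J J' J'' v w : (forall f g, J f -> J' g -> J'' (f * g)) ->
  lead J v -> lead J' w -> lead J'' (v + w)%MM.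
Proof.
move=> JJ [f [Jf fv fa]] [g [Jg gw ga]]; exists (f * g).
have [fga fgc] := above_lead fa ga.
by split; rewrite ?fgc ?mulf_neq0 //; apply: JJ.
Qed.

Lemma lead_mon J w : J (psmon w) -> lead J w.
Proof.
by move=> Jw; exists (psmon w); rewrite /= eqxx oner_eq0; split=> //;
  apply: above_mon.
Qed.

Lemma lead_add J v w : is_ideal J -> lead J v -> lead J (v + w)%MM.
Proof.
move=> idJ Jv; apply: (@leadM J setT) => [f g Jf _|//|]; first exact: idealMr.
exact: lead_mon.
Qed.

Lemma leadS J J' : (J `<=` J')%classic -> (lead J `<=` lead J')%classic.
Proof. by move=> JJ w [f [Jf fw fa]]; exists f; split=> //; apply: JJ. Qed.

Lemma ex_lead f a : pscoef f a != 0 ->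
  exists w, [/\ (w <= a)%O, pscoef f w != 0 & above w f].
Proof.
elim/(well_founded_ind (@ltom_wf m)): a => a IH fa.
case: (EM (above a f)) => [|nab]; first by exists a.
have [b [ba fb]] : exists b, (b < a)%O /\ pscoef f b != 0.
  apply: contrapT => H; apply: nab => b ba; apply/eqP; apply: contrapT => /negP fb.
  by apply: H; exists b.
have [w [wb fw wa]] := IH b ba fb.
by exists w; split=> //; apply: le_trans wb (ltW ba).
Qed.

(** Division algorithm: the leading term of [f] is cancelled by an element of [J] until the order
    reaches [r]. *)
Lemma sub_of_lead r (J J' : set Q) : is_ideal J -> is_ideal J' ->
    (J `<=` J')%classic -> (ps_ord r `<=` J)%classic ->
    (forall w, (mdeg w < r)%N -> lead J' w -> lead J w) -> (J' `<=` J)%classic.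
Proof.
move=> idJ idJ' JJ' rJ leadJ f.
(* Termination measure: the exponents of degree below [r] that are at or above the leading exponent
   of [f]. *)
pose D f : {set 'X_{1..m < r}} :=
  [set w : 'X_{1..m < r} | `[< ~ (forall v, (v <= bmnm w)%O ->
    pscoef f v = 0) >]]%SET.
have DP g (w : 'X_{1..m < r}) :
    reflect (~ (forall v, (v <= bmnm w)%O -> pscoef g v = 0)) (w \in D g).
  by rewrite inE; apply: asboolP.
have [d] := ubnP #|D f|; elim: d f => // d IH f df J'f.
case: (EM (ps_ord r f)) => [|nrf]; first exact: rJ.
have [a [ar fa]] : exists a, (mdeg a < r)%N /\ pscoef f a != 0.
  apply: contrapT => H; apply: nrf => a ar; apply/eqP; apply: contrapT => /negP fa.
  by apply: H; exists a.
have [w [wa fw af]] := ex_lead fa.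
have wr : (mdeg w < r)%N by apply: leq_ltn_trans ar; apply: lemc_mdeg.
have [g [Jg gw ag]] : lead J w by apply: leadJ => //; exists f.
pose h := psC m (pscoef f w / pscoef g w) * g.
have Jh : J h by apply: idealMl.
apply: (idealBr idJ Jh); apply: IH; last by apply: (idealB idJ') => //; apply: JJ'.
have fh v : (v <= w)%O -> pscoef (f - h) v = 0.
  rewrite le_eqVlt pscoefB pscoef_CM => /orP[/eqP ->|vw].
    by rewrite mulfVK ?subrr.
  by rewrite (af v) // (ag v) // mulr0 subrr.
rewrite -ltnS; apply: leq_trans df; rewrite ltnS.
apply: proper_card; apply/properP; split; last first.
  exists (BMultinom wr); first by apply/DP => /(_ w (lexx _)) /eqP; apply/negP.
  by apply/DP; apply => v; apply: fh.
apply/fintype.subsetP => v; move=> /DP nfh; apply/DP => fv; apply: nfh => u uv.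
case: (leP u w) => [|wu]; first exact: fh.
by have := fv w (le_trans (ltW wu) uv) => /eqP; rewrite (negbTE fw).
Qed.

(** By [sub_of_lead] each strict inclusion creates a new leading exponent of degree below [r]. *)
Lemma ideal_chain_le r J h : (ps_ord r `<=` J)%classic ->
  chain_lengths [set A | is_ideal A /\ (J `<=` A)%classic] h ->
    (h <= #|outside r (lead J)|)%N.
Proof.
move=> rJ [c [cJ cS]].
suff H i : (i <= h)%N -> (i + #|outside r (lead (c i))| <= #|outside r (lead J)|)%N.
  by apply: leq_trans (H h (leqnn h)); apply: leq_addr.
elim: i => [_|i IH ih].
  apply: subset_leq_card; apply/fintype.subsetP => w /outsideP nw;
    apply/outsideP => Jw.
  by apply: nw; apply: leadS Jw; case: (cJ 0%N).
apply: leq_trans (IH (ltnW ih)); rewrite addSn ltn_add2l.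
have [id1 Jc1] := cJ i (ltnW ih); have [id2 Jc2] := cJ i.+1 ih.
have [c12 nc21] := cS i ih.
apply: proper_card; apply/properP; split.
  by apply/fintype.subsetP => w /outsideP nw; apply/outsideP => Jw; apply: nw;
    apply: leadS Jw.
apply: contrapT => H; apply: nc21; apply: (sub_of_lead (r := r)) => //.
  exact: subset_trans Jc1.
move=> w wr lw; apply: contrapT => nlw; apply: H.
by exists (BMultinom wr); apply/outsideP => //; apply.
Qed.

(* Adjoining to [J] all series above the largest non-leading exponent [b] turns
   [b], and no other exponent, into a leading one. *)
Lemma ideal_chain_ex r J h : is_ideal J -> (h <= #|outside r (lead J)|)%N ->
  chain_lengths [set A | is_ideal A /\ (J `<=` A)%classic] h.
Proof.
elim: h J => [|h IH] J idJ hJ; first by exists (fun=> J); split=> // i _; split.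
have [b0 b0J] : exists b, b \in outside r (lead J).
  by apply/set0Pn; rewrite -card_gt0; apply: leq_trans hJ.
pose b := [arg max_(i > b0 in outside r (lead J)) bmnm i]%O.
have [bJ bmax] : b \in outside r (lead J) /\ forall i,
  i \in outside r (lead J) -> (bmnm i <= bmnm b)%O.
  by rewrite /b; case: Order.TotalTheory.arg_maxP.
pose J' : set Q := [set f : Q | exists g e, [/\ J g, above b e & f = g + e]]%classic.
have idA := above_ideal b.
have idJ' : is_ideal J'.
  split.
  - by exists 0, 0; rewrite addr0; split=> //; apply: (ideal0 idJ).
  - move=> _ _ [f [e [Jf ae ->]]] [g [d [Jg ad ->]]].
    by exists (f + g), (e + d); rewrite addrACA; split=> //;
      [apply: (idealD idJ) | apply: (idealD idA)].
  - move=> a _ [f [e [Jf ae ->]]].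
    by exists (a * f), (a * e); rewrite mulrDr; split=> //;
      [apply: (idealMl idJ) | apply: (idealMl idA)].
have JJ' : (J `<=` J')%classic.
  by move=> f Jf; exists f, 0; rewrite addr0; split=> //; apply: ideal0.
have [||c [cJ cS]] := IH J' => //.
  rewrite -ltnS; apply: leq_trans hJ _; rewrite (cardsD1 b) bJ ltnS.
  apply: subset_leq_card; apply/fintype.subsetP => w;
    rewrite in_setD1 => /andP[wb wJ].
  apply/outsideP => -[_ [[g [e [Jg ae ->]]] gew age]].
  have wltb : (bmnm w < bmnm b)%O.
    by rewrite lt_neqAle bmax // andbT (inj_eq val_inj).
  move/outsideP: wJ; apply; exists g; split=> //.
    by move: gew; rewrite pscoefD ae ?addr0.
  move=> v vw; have := age v vw; rewrite pscoefD ae ?addr0 //.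
  exact: lt_trans vw wltb.
exists (fun i => if i is i'.+1 then c i' else J); split => [[|i] ih|[|i] ih].
- by split.
- by have [idc J'c] := cJ i ih; split=> //; apply: subset_trans J'c.
- have [idc J'c] := cJ 0%N isT.
  split; first exact: subset_trans J'c.
  move=> cJ0; move/outsideP: bJ; apply; apply: lead_mon; apply: cJ0; apply: J'c.
  by exists 0, (psmon (bmnm b)); rewrite add0r; split=> //;
    [exact: ideal0 | exact: above_mon].
- exact: cS.
Qed.

Lemma length_quot_outside r J : is_ideal J -> (ps_ord r `<=` J)%classic ->
  length_quot J = #|outside r (lead J)|.
Proof.
move=> idJ rJ; apply: nat_max_eq; first exact: ideal_chain_ex.
by move=> h; apply: ideal_chain_le.
Qed.

End LeadingExponents.

(** * Ideals, primes and lengths along a surjective morphism *)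

Section SurjectiveMorphism.
Variables (Q S : comNzRingType) (phi : {rmorphism Q -> S}).
Hypothesis phi_surj : forall s, exists f, phi f = s.
Local Open Scope classical_set_scope.

Lemma preimage_ideal (I : set S) : is_ideal I -> is_ideal (phi @^-1` I).
Proof.
move=> idI; split => [|f g|a f] /=.
- by rewrite rmorph0; apply: ideal0.
- by rewrite rmorphD; apply: idealD.
- by rewrite rmorphM; apply: idealMl.
Qed.

Lemma image_ideal (J : set Q) : is_ideal J -> is_ideal (phi @` J).
Proof.
move=> idJ; split.
- by exists 0; rewrite ?rmorph0 //; apply: ideal0.
- by move=> _ _ [f Jf <-] [g Jg <-]; exists (f + g); rewrite ?rmorphD //;
  apply: idealD.
- move=> s _ [f Jf <-]; have [a <-] := phi_surj s.
  by exists (a * f); rewrite ?rmorphM //; apply: idealMl.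
Qed.

Lemma preimage_prime (P : set S) : is_prime_ideal P -> is_prime_ideal (phi @^-1` P).
Proof.
case=> idP P1 PM; split; first exact: preimage_ideal.
  by rewrite /= rmorph1.
by move=> f g; rewrite /= rmorphM; apply: PM.
Qed.

Definition ker : set Q := [set f | phi f = 0].

Lemma preimage_image (J : set Q) : is_ideal J -> ker `<=` J ->
    phi @^-1` (phi @` J) = J.
Proof.
move=> idJ kJ; apply/seteqP; split => [f [g Jg gf]|f Jf]; last by exists f.
by apply: (idealBr idJ Jg); apply: kJ; rewrite /ker /= rmorphB gf subrr.
Qed.

Lemma ker_preimage (I : set S) : is_ideal I -> ker `<=` phi @^-1` I.
Proof. by move=> idI f; rewrite /ker /= => ->; apply: ideal0. Qed.

Lemma image_prime (P : set Q) : is_prime_ideal P -> ker `<=` P ->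
    is_prime_ideal (phi @` P).
Proof.
case=> idP P1 PM kP; have E f : (phi @` P) (phi f) -> P f.
  by move=> Pf; rewrite -(preimage_image idP kP).
split; first exact: image_ideal.
  by rewrite -(rmorph1 phi) => /E.
move=> s t; have [f <-] := phi_surj s; have [g <-] := phi_surj t.
by rewrite -rmorphM => /E /PM[Pf|Pg]; [left; exists f | right; exists g].
Qed.

(** Correspondence theorem, stated once for chains of ideals and chains of primes. *)
Lemma chain_lengths_hom (CS : set (set S)) (CQ : set (set Q)) :
    (forall A, CS A -> CQ (phi @^-1` A)) -> (forall B, CQ B -> CS (phi @` B)) ->
    (forall B, CQ B -> is_ideal B /\ ker `<=` B) ->
  chain_lengths CS = chain_lengths CQ.
Proof.
move=> SQ QS idQ; apply/seteqP; split => h [c [cC cS]].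
  exists (fun i => phi @^-1` c i); split => [i /cC /SQ //|i /cS[c12 nc21]].
  split => [f /=|c21]; first exact: c12.
  by apply: nc21 => s; have [f <-] := phi_surj s; apply: c21.
exists (fun i => phi @` c i); split => [i /cC /QS //|i ih].
have [c12 nc21] := cS i ih; split; first exact: image_subset.
move=> c21; apply: nc21 => f cf.
have [id1 k1] := idQ _ (cC i (ltnW ih)).
by rewrite -(preimage_image id1 k1); apply: c21; exists f.
Qed.

Lemma length_quot_hom (I : set S) : is_ideal I ->
  length_quot I = length_quot (phi @^-1` I).
Proof.
move=> idI; congr nat_max; apply: chain_lengths_hom.
- by move=> A [idA IA]; split; [exact: preimage_ideal | move=> f; apply: IA].
- move=> B [idB IB]; split; first exact: image_ideal.
  by move=> s; have [f <-] := phi_surj s => If; exists f => //; apply: IB.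
- move=> B [idB IB]; split=> //; apply: subset_trans IB; exact: ker_preimage.
Qed.

End SurjectiveMorphism.

(** * Counting lattice points *)

Section Counting.
Variables (m r : nat) (M : set 'X_{1..m}).
Hypothesis Mr : forall w, ~ M w -> (mdeg w < r)%N.

Lemma card_outside_ge (T : finType) (A : {set T}) (f : T -> 'X_{1..m}) :
  {in A &, injective f} -> (forall x, x \in A -> ~ M (f x)) ->
  (#|A| <= #|outside r M|)%N.
Proof.
move=> f_inj fM; rewrite !cardE -(size_map f) -(size_map (@bmnm m r)).
apply: uniq_leq_size.
  rewrite map_inj_in_uniq ?enum_uniq // => x y; rewrite !mem_enum; exact: f_inj.
move=> w /mapP[x]; rewrite mem_enum => xA ->; apply/mapP.
by exists (BMultinom (Mr (fM x xA))) => //; rewrite mem_enum; apply/outsideP/fM.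
Qed.

Lemma card_outside_le (T : finType) (A : {set T}) (f : T -> 'X_{1..m}) :
  (forall w, ~ M w -> exists2 x, x \in A & w = f x) ->
  (#|outside r M| <= #|A|)%N.
Proof.
move=> fM; rewrite !cardE -(size_map f) -(size_map (@bmnm m r)).
apply: uniq_leq_size.
  by rewrite map_inj_uniq ?enum_uniq //; apply: val_inj.
move=> w /mapP[x]; rewrite mem_enum => /outsideP/fM[y yA ->] ->.
by apply/mapP; exists y; rewrite ?mem_enum.
Qed.

End Counting.

(** Counts the lattice points under the graph of [F]; the bound [C] lets the heights range over a
    finite type. *)
Lemma card_under (T : finType) (P : pred T) (F : T -> nat) C :
  (forall x, P x -> (F x <= C)%N) ->
  #|[set x : T * 'I_C | P x.1 && (x.2 < F x.1)%N]%SET| = (\sum_(x | P x) F x)%N.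
Proof.
move=> FC; rewrite -sum1_card.
rewrite (eq_bigl (fun x : T * 'I_C => P x.1 && (x.2 < F x.1)%N)); last first.
  by move=> x; rewrite inE.
rewrite -(pair_big_dep P (fun x (c : 'I_C) => (c < F x)%N) (fun _ _ => 1%N)) /=.
apply: eq_bigr => x Px.
by rewrite (big_ord_narrow (FC x Px)) sum1_card card_ord.
Qed.

(** * Sums over the lattice points of a dilated triangle *)

Section Simplex.
Local Open Scope nat_scope.

Lemma sum_simplex_card q :
  2 * \sum_(b < q.+1) \sum_(c < q.+1 | b + c <= q) 1 = q.+1 * q.+2.
Proof.
have -> : \sum_(b < q.+1) \sum_(c < q.+1 | b + c <= q) 1 = \sum_(b < q.+1) (q.+1 - b).
  apply: eq_bigr => b _.
  have bq : q.+1 - b <= q.+1 by apply: leq_subr.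
  rewrite (eq_bigl (fun c : 'I_q.+1 => c < q.+1 - b)).
    by rewrite (big_ord_narrow bq) sum1_card card_ord.
  by move=> c; have := ltn_ord b; lia.
elim: q => [|q IH]; first by rewrite big_ord1.
rewrite big_ord_recl subn0 mulnDr; under eq_bigr do rewrite lift0 subSS.
by rewrite IH; lia.
Qed.

Lemma sum_simplexl q :
  6 * \sum_(b < q.+1) \sum_(c < q.+1 | b + c <= q) b = q * q.+1 * q.+2.
Proof.
have -> : \sum_(b < q.+1) \sum_(c < q.+1 | b +
  c <= q) b = \sum_(b < q.+1) b * (q.+1 - b).
  apply: eq_bigr => b _.
  have bq : q.+1 - b <= q.+1 by apply: leq_subr.
  rewrite sum_nat_const mulnC; congr (_ * _).
  rewrite -sum1_card (eq_bigl (fun c : 'I_q.+1 => c < q.+1 - b)).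
    by rewrite (big_ord_narrow bq) sum1_card card_ord.
  by move=> c; rewrite unfold_in; have := ltn_ord b; lia.
elim: q => [|q IH]; first by rewrite big_ord1.
have E : \sum_(b < q.+2) b * (q.+2 - b) = \sum_(b < q.+1) b * (q.+1 - b) +
  \sum_(b < q.+2) b.
  rewrite big_ord_recr [\sum_(b < q.+2) b]big_ord_recr /= addnA -big_split /=.
  congr (_ + _); last by rewrite subSnn muln1.
  by apply: eq_bigr => b _; have := ltn_ord b; nia.
have S j : 2 * \sum_(b < j.+1) b = j * j.+1.
  elim: j => [|j IHj]; first by rewrite big_ord1.
  by rewrite big_ord_recr mulnDr IHj /=; lia.
rewrite E mulnDr IH; have := S q.+1; set s := \sum_(b < _) _ => sE.
have -> : 6 * s = 3 * (q.+1 * q.+2) by rewrite -sE mulnA.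
by lia.
Qed.

Lemma sum_simplexr q :
  6 * \sum_(b < q.+1) \sum_(c < q.+1 | b + c <= q) c = q * q.+1 * q.+2.
Proof.
rewrite -sum_simplexl (exchange_big_dep xpredT) //=; congr (_ * _).
by apply: eq_bigr => c _; apply: eq_bigl => b; rewrite addnC.
Qed.

(** The three barycentric coordinates add up to [q] at each point, so this sum follows from the
    other two and the number of points. *)
Lemma sum_simplex0 q :
  6 * \sum_(b < q.+1) \sum_(c < q.+1 | b + c <= q) (q - (b + c)) = q * q.+1 * q.+2.
Proof.
have := sum_simplexl q; have := sum_simplexr q; have := sum_simplex_card q.
set s1 := \sum_(b < _) _ => E1; set sr := \sum_(b < _) _ => Er.
set sl := \sum_(b < _) _ => El; set s0 := \sum_(b < _) _.
suff E : s0 + sl + sr = q * s1.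
  have : 6 * s0 + 6 * sl + 6 * sr = 3 * (q * (2 * s1)) by lia.
  by rewrite El Er E1; lia.
rewrite /s0 /sl /sr /s1 -!big_split big_distrr /=; apply: eq_bigr => b _.
rewrite -!big_split big_distrr /=; apply: eq_bigr => c bc.
by rewrite muln1; lia.
Qed.

(** The mean of an affine function over the triangle is the mean [q * (x + y + z) / 3] of its values
    at the vertices. *)
Lemma sum_simplex_lin q x y z :
  6 * \sum_(b < q.+1) \sum_(c < q.+1 | b + c <= q) ((q - (b + c)) * x + b * y +
    c * z) =
  q * q.+1 * q.+2 * (x + y + z).
Proof.
rewrite !mulnDr -{1}(sum_simplex0 q) -{1}(sum_simplexl q) -(sum_simplexr q).
rewrite -!mulnA -!mulnDr; congr (_ * _).
rewrite !big_distrl -!big_split /=; apply: eq_bigr => b _.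
by rewrite !big_distrl -!big_split.
Qed.

End Simplex.

(** * Lattice points over a chain of quadrants glued along rays *)

Section Fan.
Variables (m n : nat) (pos : nat -> 'I_m) (ht : 'I_m).
Hypothesis n0 : (0 < n)%N.
Hypothesis pos_inj : forall p q, (p <= n)%N -> (q <= n)%N -> pos p = pos q -> p = q.
Hypothesis pos_ht : forall p, (p <= n)%N -> pos p != ht.

(* The lattice point with coordinates [a], [b] in the [i]-th plane of the chain
   and height [c]. *)
Definition fan_pt i a b c : 'X_{1..m} :=
  (U_(pos i) *+ a + U_(pos i.+1) *+ b + U_(ht) *+ c)%MM.

Lemma fan_ptE i a b c l : fan_pt i a b c l =
  ((pos i == l) * a + (pos i.+1 == l) * b + (ht == l) * c)%N.
Proof. by rewrite !mnmDE !mulmnE !mnm1E. Qed.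

Lemma fan_pt_ht i a b c : (i < n)%N -> fan_pt i a b c ht = c.
Proof.
move=> ni; rewrite fan_ptE eqxx mul1n !(negbTE (pos_ht _)) ?mul0n //.
exact: ltnW.
Qed.

Lemma fan_pt_pos i a b c p : (i < n)%N -> (p <= n)%N ->
  fan_pt i a b c (pos p) = ((i == p) * a + (i.+1 == p) * b)%N.
Proof.
move=> ni pn; have posE q : (q <= n)%N -> (pos q == pos p) = (q == p).
  by move=> qn; apply/eqP/eqP => [/pos_inj ->|->].
have hp : (ht == pos p) = false by rewrite eq_sym; apply/negbTE/pos_ht.
by rewrite fan_ptE hp mul0n addn0 !posE // ltnW.
Qed.

(* Points on the ray shared by the planes [i] and [i.+1] are written in plane [i]. *)
Lemma fan_pt_inj i a b c i' a' b' c' : (i < n)%N -> (i' < n)%N ->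
    ((i == 0) || (0 < b))%N -> ((i' == 0) || (0 < b'))%N ->
  fan_pt i a b c = fan_pt i' a' b' c' -> [/\ i = i', a = a', b = b' & c = c'].
Proof.
move=> ni ni' ib ib' E.
have Ep p : (p <= n)%N -> ((i == p) * a + (i.+1 == p) * b =
                           (i' == p) * a' + (i'.+1 == p) * b')%N.
  by move=> pn; rewrite -(fan_pt_pos _ _ c) // -(fan_pt_pos _ _ c') // E.
have cc : c = c' by rewrite -(fan_pt_ht a b c ni) E fan_pt_ht.
have [Ei|ii] := eqVneq i i'; last first.
  by move: ib ib' (Ep i.+1 ni) (Ep i'.+1 ni'); move/eqP: ii => ii; lia.
move: (Ep i (ltnW ni)) (Ep i.+1 ni); rewrite -Ei !eqxx.
by split=> //; lia.
Qed.

Section LowerCount.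
Variables (r : nat) (M : set 'X_{1..m}).
Hypothesis Mr : forall w, ~ M w -> (mdeg w < r)%N.

(** The condition on [b] removes from every plane but the first the ray shared with its predecessor,
    so that no point is counted twice. *)
Lemma count_ge D (H : nat -> nat -> nat -> nat) :
    (forall i a b c, (i < n)%N -> (c < H i a b)%N -> ~ M (fan_pt i a b c)) ->
  (\sum_(i < n) \sum_(a < D) \sum_(b < D | (i == 0%N :> nat) || (0 < b)) H i a b
     <= #|outside r M|)%N.
Proof.
move=> MH.
pose T : finType := ('I_n * 'I_D * 'I_D)%type.
pose P (x : T) := (x.1.1 == 0%N :> nat) || (0 < x.2)%N.
pose F (x : T) := H x.1.1 x.1.2 x.2.
have -> : (\sum_(i < n) \sum_(a < D) \sum_(b < D | (i == 0%N :> nat) || (0 < b))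
  H i a b =
           \sum_(x | P x) F x)%N.
  by rewrite pair_big /= pair_big_dep.
rewrite -(@card_under T P F (\max_(x : T) F x)); last by move=> x _;
  apply: leq_bigmax.
apply: (card_outside_ge Mr (f := fun x : T * 'I_(\max_(x : T) F x) =>
    fan_pt x.1.1.1 x.1.1.2 x.1.2 x.2)).
  move=> [[[i a] b] c] [[[i' a'] b'] c']; rewrite !inE /= => /andP[Px _] /andP[Px' _].
  case/(fan_pt_inj (ltn_ord i) (ltn_ord i') Px Px').
  by move=> /= Ei Ea Eb Ec; congr (_, _, _, _); apply: val_inj.
by move=> [[[i a] b] c]; rewrite !inE /= => /andP[_ cF]; apply: MH.
Qed.

(** Exponents with positive second coordinate give [n] disjoint tetrahedra, each with
    [q * q.+1 * q.+2 / 6] points. *)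
Lemma count_ge_simplex q :
    (forall i a b c, (i < n)%N -> (a + b + c < q)%N -> ~ M (fan_pt i a b.+1 c)) ->
  (n * (q * q.+1 * q.+2) <= 6 * #|outside r M|)%N.
Proof.
move=> MH.
pose H (i a b : nat) := (if b is b'.+1 then q - (a + b') else 0)%N.
have : (n * \sum_(a < q.+1) \sum_(b < q.+1 | a + b <= q) (q - (a +
  b)) <= #|outside r M|)%N.
  have MH' i a b c : (i < n)%N -> (c < H i a b)%N -> ~ M (fan_pt i a b c).
    by case: b => [|b] //= ni cH; apply: MH => //; lia.
  apply: leq_trans (count_ge q.+2 MH').
  rewrite -[X in (X * _)%N]card_ord -sum_nat_const; apply: leq_sum => i _.
  rewrite [leqRHS]big_ord_recr /=; apply: leq_trans (leq_addr _ _).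
  apply: leq_sum => a _; rewrite [leqRHS]big_mkcond big_ord_recl.
  rewrite big_mkcond; apply: leq_trans (leq_addl _ _); apply: leq_sum => b _.
  by rewrite !lift0 orbT /=; case: ifP.
by rewrite -(sum_simplex0 q); lia.
Qed.

End LowerCount.

(** * Heights over the triangulated chain and the two main counting bounds *)

Section Heights.
Variables (M : set 'X_{1..m}) (h : 'X_{1..m} -> nat) (D : nat).
Hypothesis MD : forall v w, M v -> M (v + w)%MM.
Hypothesis hP : forall w c, M (w + U_(ht) *+ c)%MM <-> (h w <= c)%N.
Hypothesis posD : forall p, (p <= n)%N -> M (U_(pos p) *+ D)%MM.

Let H i a b := h (fan_pt i a b 0).

Lemma fan_ptc i a b c : fan_pt i a b c = (fan_pt i a b 0 + U_(ht) *+ c)%MM.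
Proof. by rewrite /fan_pt mulm0n addm0. Qed.

Lemma fan_ptP i a b c : M (fan_pt i a b c) <-> (H i a b <= c)%N.
Proof. by rewrite fan_ptc; apply: hP. Qed.

Lemma fan_pt_out i a b c : (i < n)%N -> (D <= a)%N || (D <= b)%N ->
    M (fan_pt i a b c).
Proof.
move=> ni /orP[Da|Db].
  have -> : fan_pt i a b c = (U_(pos i) *+ D + fan_pt i (a - D) b c)%MM.
    apply/mnmP => l; rewrite mnmDE !fan_ptE mulmnE mnm1E -{1}(subnK Da).
    by ring.
  by apply: MD; apply: posD; apply: ltnW.
have -> : fan_pt i a b c = (U_(pos i.+1) *+ D + fan_pt i a (b - D) c)%MM.
  apply/mnmP => l; rewrite mnmDE !fan_ptE mulmnE mnm1E -{1}(subnK Db).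
  by ring.
by apply: MD; apply: posD.
Qed.

Lemma H_out i a b : (i < n)%N -> (D <= a)%N || (D <= b)%N -> H i a b = 0%N.
Proof.
by move=> ni ab; apply/eqP; rewrite -leqn0; apply/fan_ptP/fan_pt_out.
Qed.

(** Vertex heights summed over the two triangles of each unit square: the ends of the antidiagonal
    belong to both, whence the coefficients 2. *)
Definition triangle_sum : nat := \sum_(i < n) \sum_(a < D) \sum_(b < D)
  (H i a b + 2 * H i a.+1 b + 2 * H i a b.+1 + H i a.+1 b.+1)%N.

(** Points outside [M'] lie under the function that is affine on each [q]-dilated triangle and takes
    [q] times the heights at its vertices; [sum_simplex_lin] sums it. Points on common edges may be
    counted twice, which is harmless for an upper bound. *)
Lemma count_le q r (M' : set 'X_{1..m}) : (0 < q)%N ->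
    (forall v w, M' v -> M' (v + w)%MM) ->
    (forall w, ~ M' w -> exists i a b c, (i < n)%N /\ w = fan_pt i a b c) ->
    (forall x y z u v w, M u -> M v -> M w -> (x + y + z = q)%N ->
       M' (u *+ x + v *+ y + w *+ z)%MM) ->
  (6 * #|outside r M'| <= q * q.+1 * q.+2 * triangle_sum)%N.
Proof.
move=> q0 M'D M'fan M'q.
(* Interpolated heights on the lower and upper triangle of a square; in [up] the coordinates [y],
   [z] are measured backwards from the corner [(a.+1, b.+1)]. *)
pose lo i a b y z := ((q - (y + z)) * H i a b + y * H i a.+1 b + z * H i a b.+1)%N.
pose up i a b y z := ((q - (y + z)) * H i a.+1 b.+1 + y * H i a b.+1 +
  z * H i a.+1 b)%N.
have loM i a b y z : (y + z <= q)%N ->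
    M' (fan_pt i (q * a + y) (q * b + z) (lo i a b y z)).
  move=> yz.
  have := M'q (q - (y + z))%N y z (fan_pt i a b (H i a b)) (fan_pt i a.+1 b (H i
    a.+1 b))
     (fan_pt i a b.+1 (H i a b.+1)).
  set X := (X in _ -> _ -> _ -> _ -> M' X).
  have -> : X = fan_pt i (q * a + y) (q * b + z) (lo i a b y z).
    have [s sE] : exists s, (q = s + (y + z))%N by exists (q - (y + z))%N;
      rewrite subnK.
    have yzE : (q - (y + z) = s)%N by lia.
    apply/mnmP => l; rewrite /X /lo !(mnmDE, mulmnE, mnm1E) yzE sE; ring.
  by apply; [apply/fan_ptP..|lia].
have upM i a b y z : (y + z <= q)%N ->
    M' (fan_pt i (q * a + (q - y)) (q * b + (q - z)) (up i a b y z)).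
  move=> yz.
  have := M'q (q - (y + z))%N y z (fan_pt i a.+1 b.+1 (H i a.+1 b.+1))
     (fan_pt i a b.+1 (H i a b.+1)) (fan_pt i a.+1 b (H i a.+1 b)).
  set X := (X in _ -> _ -> _ -> _ -> M' X).
  have -> : X = fan_pt i (q * a + (q - y)) (q * b + (q - z)) (up i a b y z).
    have [s sE] : exists s, (q = s + (y + z))%N by exists (q - (y + z))%N;
      rewrite subnK.
    have yE : (q - y = s + z)%N by lia.
    have zE : (q - z = s + y)%N by lia.
    have yzE : (q - (y + z) = s)%N by lia.
    apply/mnmP => l; rewrite /X /up !(mnmDE, mulmnE, mnm1E) yE zE yzE sE; ring.
  by apply; [apply/fan_ptP..|lia].
pose T : finType := ('I_n * 'I_D * 'I_D * bool * 'I_q.+1 * 'I_q.+1)%type.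
pose P (x : T) := (x.1.2 + x.2 <= q)%N.
pose F (x : T) := let: (i, a, b, s, y, z) := x in
  if s then lo i a b y z else up i a b y z.
pose f (x : T * 'I_(\max_(x : T) F x)) := let: (i, a, b, s, y, z, c) := x in
  if s then fan_pt i (q * a + y) (q * b + z) c
  else fan_pt i (q * a + (q - y)) (q * b + (q - z)) c.
have FC x : P x -> (F x <= \max_(x : T) F x)%N by move=> _; apply: leq_bigmax.
have := card_under FC; set A := [set _ | _]%SET => cardA.
have : (#|outside r M'| <= #|A|)%N.
  (* Euclidean division by [q] finds the dilated square, and the sum of the two remainders decides
     between its triangles. *)
  apply: (@card_outside_le _ r M' _ A f) => w nw.
  have [i [a [b [c [ni wE]]]]] := M'fan w nw.
  have ya := ltn_pmod a q0; have zb := ltn_pmod b q0.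
  have key (x : T) : P x -> (forall e, (F x <= e)%N -> M' (fan_pt i a b e)) ->
      (forall e : 'I_(\max_(x : T) F x), f (x, e) = fan_pt i a b e) ->
      exists2 x, x \in A & w = f x.
    move=> Px FM fE.
    have cF : (c < F x)%N.
      by rewrite ltnNge; apply/negP => /FM; rewrite -wE.
    exists (x, Ordinal (leq_trans cF (FC x Px))); first by rewrite inE Px.
    by rewrite fE wE.
  have addc i' a' b' e d : M' (fan_pt i' a' b' e) -> (e <= d)%N ->
    M' (fan_pt i' a' b' d).
    move=> Me ed; have -> : fan_pt i' a' b' d = (fan_pt i' a' b' e +
      U_(ht) *+ (d - e))%MM.
      apply/mnmP => l; rewrite mnmDE !fan_ptE mulmnE mnm1E -{1}(subnK ed); ring.
    exact: M'D.
  have aE : a = (q * (a %/ q) + a %% q)%N by rewrite mulnC -divn_eq.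
  have bE : b = (q * (b %/ q) + b %% q)%N by rewrite mulnC -divn_eq.
  have aK : (q - (q - a %% q) = a %% q)%N by rewrite subKn // ltnW.
  have bK : (q - (q - b %% q) = b %% q)%N by rewrite subKn // ltnW.
  (* Beyond [D] all vertex heights vanish, so the whole column already lies in [M']. *)
  have out : (D <= a %/ q)%N || (D <= b %/ q)%N -> False.
    move=> ab; apply: nw; rewrite wE.
    have H0 x y : (a %/ q <= x)%N -> (b %/ q <= y)%N -> H i x y = 0%N.
      by move=> ax by_; apply: H_out => //; case/orP: ab => ab; apply/orP;
        [left|right];
        apply: leq_trans ab _.
    case: (leqP (a %% q + b %% q) q) => yz.
      apply: (addc _ _ _ 0%N) => //.
      have := loM i (a %/ q)%N (b %/ q)%N _ _ yz.
      by rewrite -aE -bE /lo !H0 // !muln0.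
    apply: (addc _ _ _ 0%N) => //.
    have := upM i (a %/ q)%N (b %/ q)%N (q - a %% q)%N (q - b %% q)%N.
    rewrite aK bK -aE -bE /up !H0 // !muln0; apply; lia.
  have aD : (a %/ q < D)%N by rewrite ltnNge; apply/negP => ab; apply: out;
    rewrite ab.
  have bD : (b %/ q < D)%N by rewrite ltnNge; apply/negP => ab; apply: out;
    rewrite ab orbT.
  case: (leqP (a %% q + b %% q) q) => yz.
    have yq : (a %% q < q.+1)%N by lia.
    have zq : (b %% q < q.+1)%N by lia.
    apply: (key (Ordinal ni, Ordinal aD, Ordinal bD, true, Ordinal yq,
      Ordinal zq)) => //=.
      by move=> e Fe; apply: addc Fe; rewrite {1}aE {1}bE; apply: loM.
    by move=> e; rewrite -aE -bE.
  have yq : (q - a %% q < q.+1)%N by lia.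
  have zq : (q - b %% q < q.+1)%N by lia.
  have yz' : (q - a %% q + (q - b %% q) <= q)%N by lia.
  apply: (key (Ordinal ni, Ordinal aD, Ordinal bD, false, Ordinal yq,
    Ordinal zq)) => //=.
    move=> e Fe; apply: addc Fe.
    by have := upM i (a %/ q)%N (b %/ q)%N _ _ yz'; rewrite aK bK -aE -bE.
  by move=> e; rewrite aK bK -aE -bE.
rewrite cardA => leA; apply: leq_trans (leq_mul (leqnn 6) leA) _.
have -> : (\sum_(x | P x) F x = \sum_(i < n) \sum_(a < D) \sum_(b < D) \sum_(s : bool)
    \sum_(y < q.+1) \sum_(z < q.+1 | y + z <= q)
      if s then lo i a b y z else up i a b y z)%N.
  rewrite pair_big /= pair_big /= pair_big /= pair_big /= pair_big_dep /=.
  apply: eq_big => [x|x _]; first by [].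
  by move: x => [[[[[i a] b] s] y] z].
rewrite /triangle_sum !big_distrr /=; apply: leq_sum => i _.
rewrite !big_distrr /=; apply: leq_sum => a _.
rewrite !big_distrr /=; apply: leq_sum => b _.
rewrite big_bool /= mulnDr !sum_simplex_lin -mulnDr leq_mul2l; apply/orP; right.
by lia.
Qed.

Let X i := (\sum_(a < D) \sum_(b < D) H i a b)%N.
Let A p := (\sum_(a < D) h (U_(pos p) *+ a)%MM)%N.

Let sum_shift (f : nat -> nat) : f D = 0%N ->
  (\sum_(a < D) f a.+1 + f 0 = \sum_(a < D) f a)%N.
Proof.
move=> fD; transitivity (\sum_(a < D.+1) f a)%N; first by rewrite big_ord_recl addnC.
by rewrite big_ord_recr /= fD addn0.
Qed.

Let Hi0 i a : H i a 0 = h (U_(pos i) *+ a)%MM.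
Proof. by rewrite /H /fan_pt !mulm0n !addm0. Qed.

Let H0i i b : H i 0 b = h (U_(pos i.+1) *+ b)%MM.
Proof. by rewrite /H /fan_pt !mulm0n !addm0 add0m. Qed.

(** Within one plane an interior point belongs to 6 triangles, a nonzero point of a bounding ray to
    3, and the origin to 6 - 3 - 3 + 1 = 1. *)
Lemma triangle_sum_plane i : (i < n)%N ->
  (\sum_(a < D) \sum_(b < D) (H i a b + 2 * H i a.+1 b + 2 * H i a b.+1 +
    H i a.+1 b.+1)
   + 3 * A i + 3 * A i.+1 = 6 * X i + h 0%MM)%N.
Proof.
move=> ni.
have HaD b : H i D b = 0%N by rewrite H_out ?leqnn.
have HbD a : H i a D = 0%N by rewrite H_out ?leqnn ?orbT.
have S1 : (\sum_(a < D) \sum_(b < D) H i a.+1 b + A i.+1 = X i)%N.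
  rewrite /A; under [X in (_ + X)%N]eq_bigr do rewrite -H0i.
  by rewrite (sum_shift (f := fun a => \sum_(b < D) H i a b)%N) // big1.
have S2 : (\sum_(a < D) \sum_(b < D) H i a b.+1 + A i = X i)%N.
  rewrite /A; under [X in (_ + X)%N]eq_bigr do rewrite -Hi0.
  by rewrite -big_split /=; apply: eq_bigr => a _; apply: (sum_shift (f := H i a)).
have S3 : (\sum_(a < D) \sum_(b < D) H i a.+1 b.+1 + A i =
           \sum_(a < D) \sum_(b < D) H i a.+1 b + h 0%MM)%N.
  have -> : A i = (\sum_(a < D) H i a.+1 0 + h 0%MM)%N.
    have <- : H i 0 0 = h 0%MM by rewrite Hi0 mulm0n.
    by rewrite (sum_shift (f := fun a => H i a 0)) //; apply: eq_bigr => a _;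
      rewrite Hi0.
  rewrite addnA -big_split /=; congr addn.
  by apply: eq_bigr => a _; apply: (sum_shift (f := H i a.+1)).
have -> : (\sum_(a < D) \sum_(b < D)
    (H i a b + 2 * H i a.+1 b + 2 * H i a b.+1 + H i a.+1 b.+1) =
  X i + 2 * \sum_(a < D) \sum_(b < D) H i a.+1 b +
  2 * \sum_(a < D) \sum_(b < D) H i a b.+1 +
    \sum_(a < D) \sum_(b < D) H i a.+1 b.+1)%N.
  rewrite /X !big_distrr -!big_split; apply: eq_bigr => a _ /=.
  by rewrite !big_distrr -!big_split.
by lia.
Qed.

Lemma triangle_sum_le r : (forall w, ~ M w -> (mdeg w < r)%N) -> (0 < D)%N ->
  (triangle_sum + 6 * h 0%MM <= 6 * #|outside r M| + n * h 0%MM)%N.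
Proof.
move=> Mr D0.
have planes : (triangle_sum + 3 * \sum_(i < n) A i + 3 * \sum_(i < n) A i.+1 =
    6 * \sum_(i < n) X i + n * h 0%MM)%N.
  have -> : (n * h 0%MM = \sum_(i < n) h 0%MM)%N by rewrite sum_nat_const card_ord.
  rewrite /triangle_sum !big_distrr -!big_split /=.
  by apply: eq_bigr => i _; apply: triangle_sum_plane.
have A0 p : (h 0%MM <= A p)%N.
  by rewrite /A (bigD1 (Ordinal D0)) //= mulm0n leq_addr.
(* [count_ge] counts shared rays once, whereas the sum of the [X i] counts them twice. *)
have LE : (\sum_(i < n) \sum_(a < D) \sum_(b < D | (i == 0%N :> nat) || (0 < b))
  H i a b
    + \sum_(i < n.-1) A i.+1 = \sum_(i < n) X i)%N.
  case: (n) n0 => // n' _ /=; rewrite !big_ord_recl /= -addnA; congr addn.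
  rewrite -big_split /=; apply: eq_bigr => i _; rewrite /A /X -big_split /=.
  apply: eq_bigr => a _; rewrite -Hi0 [RHS](bigD1 (Ordinal D0)) //= addnC; congr addn.
  by apply: eq_bigl => b; rewrite lt0n.
have E1 : (\sum_(i < n) A i = A 0 + \sum_(i < n.-1) A i.+1)%N.
  by case: (n) n0 => // n' _; rewrite big_ord_recl.
have E2 : (\sum_(i < n) A i.+1 = \sum_(i < n.-1) A i.+1 + A n)%N.
  by case: (n) n0 => // n' _; rewrite big_ord_recr.
(* The outer rays remain with coefficient 3 each, and both contain the origin: this yields the term
   [6 * h 0]. *)
have := A0 0%N; have := A0 n.
have L : (\sum_(i < n) \sum_(a < D) \sum_(b < D | (i == 0%N :> nat) || (0 < b)) H
  i a b
     <= #|outside r M|)%N.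
  by apply: count_ge => // i a b c ni cH /fan_ptP; rewrite leqNgt cH.
by lia.
Qed.

End Heights.

End Fan.

(** * The polygonal cone as a quotient of a power series ring *)

Section QuotientMap.
Local Open Scope quotient_scope.
Variables (R : comNzRingType) (J : set R) (idJ : is_ideal J) (J1 : ~ J 1).

Definition quot_map (x : R) : quotient_ring idJ J1 :=
  \pi_({ideal_quot (proper_idealr idJ J1)}) x.

Fact quot_map_zmod : zmod_morphism quot_map.
Proof. exact: rmorphB. Qed.

Fact quot_map_monoid : monoid_morphism quot_map.
Proof. by split; [exact: rmorph1 | exact: rmorphM]. Qed.

HB.instance Definition _ :=
  GRing.isZmodMorphism.Build R (quotient_ring idJ J1) quot_map quot_map_zmod.
HB.instance Definition _ :=
  GRing.isMonoidMorphism.Build R (quotient_ring idJ J1) quot_map quot_map_monoid.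

Lemma quot_map_eq0 x : quot_map x = 0 <-> J x.
Proof.
rewrite -(rmorph0 quot_map) /quot_map -{2}(subr0 x).
have := Quotient.idealrBE (proper_idealr idJ J1) x 0.
rewrite unfold_in => E; split => [/eqP|Jx]; first by rewrite -E => /asboolP.
by apply/eqP; rewrite -E; apply/asboolP.
Qed.

Lemma quot_map_surj y : exists x, quot_map x = y.
Proof. by exists (repr (y : {ideal_quot (proper_idealr idJ J1)})); apply: reprK. Qed.

End QuotientMap.

(** * Membership in the ideal of the cone *)

Section ConePrimes.
Variables (k : fieldType) (n : nat).
Hypothesis n2 : (2 <= n)%N.
Notation A := (powerseries n.+1 k).

(* The two variables that do not belong to the [i]-th prime. *)
Definition cone_plane (i : nat) (l : 'I_n.+1) : bool :=
  (l == inZp (i + n.-1)) || (l == inZp (i.+1 + n.-1)).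

Lemma cone_gen_plane (i : 'I_n) j : (j < n.-1)%N -> ~~ cone_plane i (inZp (i + j)).
Proof.
move=> jn; rewrite /cone_plane -!val_eqE /= addSn -addnS.
by rewrite !eqn_modDl !modn_small; lia.
Qed.

Lemma cone_plane_gen (i : 'I_n) (l : 'I_n.+1) : ~~ cone_plane i l ->
  exists2 j, (j < n.-1)%N & l = inZp (i + j).
Proof.
move=> nl; have ln := ltn_ord l; have ni := ltn_ord i.
pose j := (if i <= l then l - i else l + n.+1 - i)%N.
have lE : l = inZp (i + j).
  apply: val_inj; rewrite /= /j; case: (leqP i l) => il.
    by rewrite subnKC // modn_small.
  by rewrite subnKC ?modnDr ?modn_small //; lia.
exists j => //; rewrite ltnNge; apply/negP => nj.
have : (j < n.+1)%N by rewrite /j; case: (leqP i l); lia.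
rewrite ltnS leq_eqVlt => /orP[/eqP jn|jn].
  by case/negP: nl; rewrite /cone_plane lE jn addSn -addnS prednK ?eqxx ?orbT //; lia.
have je : j = n.-1 by lia.
by case/negP: nl; rewrite /cone_plane lE je eqxx.
Qed.

(** The generators are the variables off the plane: the condition defines an ideal containing them,
    and conversely [ps_decomp] divides by them. *)
Lemma cone_primeP (i : 'I_n) (g : A) : cone_prime i g <->
  forall v : 'X_{1..n.+1}, (forall l, v l != 0 -> cone_plane i l)%N -> pscoef g v = 0.
Proof.
split => [|gv].
  pose Z : set A := [set g : A |
    forall v : 'X_{1..n.+1}, (forall l, v l != 0 -> cone_plane i l)%N ->
      pscoef g v = 0]%classic.
  move=> /(_ Z); apply; split; first split => //.
  - by move=> f h Zf Zh v vi; rewrite pscoefD Zf ?Zh ?addr0.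
  - move=> a f Zf v vi; rewrite pscoefM big1 // => b /eqP vb.
    rewrite (Zf b.2) ?mulr0 // => l bl; apply: vi.
    by rewrite vb mnmDE addn_eq0 negb_and bl orbT.
  - move=> _ [j /= jn <-] v vi /=; case: eqP => // vj.
    have := cone_gen_plane i jn; rewrite vi // vj mnm1E eqxx //.
have [v gv0|F [-> _]] := @ps_decomp n.+1 k n.-1 (fun j => U_(inZp (i + j)))%MM g.
  apply: contrapT => H; case/eqP: gv0; apply: gv => l vl.
  apply: contrapT => /negP /cone_plane_gen [j jn lE]; apply: H.
  by exists (Ordinal jn); rewrite /= -lE lep1mP.
have idG := ideal_gen_ideal
  [set psvar k (inZp (i + j)%N : 'I_n.+1) | j in [set j | (j < n.-1)%N]]%classic.
apply: (ideal_sum idG) => j _; apply: (idealMr idG) => I [_]; apply.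
by exists (nat_of_ord j) => //=; apply: ltn_ord.
Qed.

Lemma cone_idealP (g : A) : cone_ideal g <->
  forall (i : 'I_n) (v : 'X_{1..n.+1}), (forall l, v l != 0 ->
    cone_plane i l)%N -> pscoef g v = 0.
Proof.
split => [Pg i|gv i _]; first by apply/cone_primeP; apply: Pg.
by apply/cone_primeP => v; apply: gv.
Qed.

End ConePrimes.

(** * Splitting off the variable [T] *)

Section Comb.
Variable n : nat.

(* The exponent of the last variable, which stands for [T], is put apart. *)
Definition mnm_rcons (v : 'X_{1..n}) (c : 'X_{1..1}) : 'X_{1..n.+1} :=
  [multinom (if unlift ord_max i is Some j then v j else c ord0) | i < n.+1].

Lemma mnm_rcons_lift v c j : mnm_rcons v c (lift ord_max j) = v j.
Proof. by rewrite mnmE liftK. Qed.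

Lemma mnm_rcons_max v c : mnm_rcons v c ord_max = c ord0.
Proof. by rewrite mnmE unlift_none. Qed.

Lemma mnm_rconsD v c v' c' :
  (mnm_rcons v c + mnm_rcons v' c')%MM = mnm_rcons (v + v')%MM (c + c')%MM.
Proof.
apply/mnmP => i; rewrite mnmDE; case: (unliftP ord_max i) => [j ->|->].
  by rewrite !mnm_rcons_lift mnmDE.
by rewrite !mnm_rcons_max mnmDE.
Qed.

Lemma mnm_rcons_inj v c v' c' : mnm_rcons v c = mnm_rcons v' c' -> v = v' /\ c = c'.
Proof.
move=> E; split; apply/mnmP => i.
  by rewrite -(mnm_rcons_lift v c) E mnm_rcons_lift.
by rewrite (ord1 i) -(mnm_rcons_max v c) E mnm_rcons_max.
Qed.

Lemma mnm_rcons_surj w : exists v c, w = mnm_rcons v c.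
Proof.
exists [multinom w (lift ord_max j) | j < n], [multinom w ord_max | _ < 1].
apply/mnmP => i; case: (unliftP ord_max i) => [j ->|->].
  by rewrite mnm_rcons_lift mnmE.
by rewrite mnm_rcons_max mnmE.
Qed.

Variable k : comNzRingType.

Definition ps_slice (f : powerseries n.+1 k) (c : 'X_{1..1}) : powerseries n k :=
  PSeries (fun v => pscoef f (mnm_rcons v c)).

(** Decompositions of a combined exponent are pairs of decompositions of its two parts. *)
Lemma ps_sliceM f g c : ps_slice (f * g) c =
  \sum_(d : 'X_{1..1 < (mdeg c).+1, (mdeg c).+1} | c == (d.1 + d.2)%MM)
    ps_slice f d.1 * ps_slice g d.2.
Proof.
apply: psP => v; rewrite pscoef_sum.
rewrite -[LHS]/(pscoef (f * g) (mnm_rcons v c)).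
under [RHS]eq_bigr do rewrite pscoefM.
pose sd := [seq d <- index_enum ('X_{1..1 < (mdeg c).+1} * 'X_{1..1 < (mdeg
  c).+1})%type
  | c == (bmnm d.1 + bmnm d.2)%MM].
pose se := [seq e <- index_enum ('X_{1..n < (mdeg v).+1} * 'X_{1..n < (mdeg
  v).+1})%type
  | v == (bmnm e.1 + bmnm e.2)%MM].
pose h (d : 'X_{1..1 < (mdeg c).+1} * 'X_{1..1 < (mdeg c).+1})
  (e : 'X_{1..n < (mdeg v).+1} * 'X_{1..n < (mdeg v).+1}) :=
  (mnm_rcons (bmnm e.1) (bmnm d.1), mnm_rcons (bmnm e.2) (bmnm d.2)).
rewrite (@pscoefM_seq _ _ [seq h d e | d <- sd, e <- se]).
- rewrite big_allpairs_dep big_filter; apply: eq_bigr => d _.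
  by rewrite big_filter.
- apply: allpairs_uniq; rewrite ?filter_uniq ?index_enum_uniq //.
  move=> [[d1 d2] [e1 e2]] [[d1' d2'] [e1' e2']] _ _ E.
  have /mnm_rcons_inj[/val_inj e1E /val_inj d1E] := congr1 fst E.
  have /mnm_rcons_inj[/val_inj e2E /val_inj d2E] := congr1 snd E.
  by move: e1E d1E e2E d2E => /= -> -> -> ->.
- move=> [w1 w2]; apply/allpairsP/eqP => [[[d e] /= [+ + [-> ->]]]|/=].
    by rewrite !mem_filter mnm_rconsD => /andP[/eqP <- _] /andP[/eqP <- _].
  have [v1 [c1 ->]] := mnm_rcons_surj w1; have [v2 [c2 ->]] := mnm_rcons_surj w2.
  rewrite mnm_rconsD => /mnm_rcons_inj[vE cE].
  have hv1 : (mdeg v1 < (mdeg v).+1)%N by rewrite vE mdegD ltnS leq_addr.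
  have hv2 : (mdeg v2 < (mdeg v).+1)%N by rewrite vE mdegD ltnS leq_addl.
  have hc1 : (mdeg c1 < (mdeg c).+1)%N by rewrite cE mdegD ltnS leq_addr.
  have hc2 : (mdeg c2 < (mdeg c).+1)%N by rewrite cE mdegD ltnS leq_addl.
  exists ((BMultinom hc1, BMultinom hc2), (BMultinom hv1, BMultinom hv2)).
  by rewrite !mem_filter !mem_index_enum /= -vE -cE !eqxx.
Qed.

End Comb.

(** * The surjection from the big power series ring and its kernel *)

Section ConeMap.
Variables (k : fieldType) (n : nat) (n2 : (2 <= n)%N).
Notation Q := (powerseries n.+2 k).
Notation S := (powerseries 1 (polygonal_cone k n2)).

Definition cone_quot : {rmorphism powerseries n.+1 k -> polygonal_cone k n2} :=
  quot_map (cone_ideal_ideal k n) (cone_ideal_proper n2).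

Definition cone_map (f : Q) : S := PSeries (fun c => cone_quot (ps_slice f c)).

Fact cone_map_zmod : zmod_morphism cone_map.
Proof.
move=> f g; apply: psP => c; rewrite pscoefB /=.
have -> : ps_slice (f - g) c = ps_slice f c - ps_slice g c by exact: psP.
exact: rmorphB.
Qed.

Fact cone_map_monoid : monoid_morphism cone_map.
Proof.
split.
  apply: psP => c; rewrite pscoef1 /=.
  have [-> |c0] := eqVneq c 0%MM.
    suff -> : ps_slice 1 0%MM = 1 :> powerseries n.+1 k by exact: rmorph1.
    apply: psP => v /=.
    congr (_%:R); congr nat_of_bool; apply/eqP/eqP => [E|->].
      by apply/mnmP => i; rewrite -(mnm_rcons_lift v 0%MM) E !mnm0E.
    apply/mnmP => i; case: (unliftP ord_max i) => [j ->|->].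
      by rewrite mnm_rcons_lift !mnm0E.
    by rewrite mnm_rcons_max !mnm0E.
  suff -> : ps_slice 1 c = 0 :> powerseries n.+1 k by exact: rmorph0.
  apply: psP => v /=.
  case: eqP => // E; case/eqP: c0; apply/mnmP => i.
  by rewrite (ord1 i) -(mnm_rcons_max v c) E !mnm0E.
move=> f g; apply: psP => c; rewrite /= ps_sliceM rmorph_sum.
by apply: eq_bigr => d _; rewrite rmorphM.
Qed.

HB.instance Definition _ := GRing.isZmodMorphism.Build Q S cone_map cone_map_zmod.
HB.instance Definition _ := GRing.isMonoidMorphism.Build Q S cone_map cone_map_monoid.

Lemma cone_map_surj s : exists f, cone_map f = s.
Proof.
have [G GE] := choice (fun c => quot_map_surj (pscoef s c)).
exists (PSeries (fun w => pscoef (G [multinom w ord_max | _ < 1])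
                            [multinom w (lift ord_max j) | j < n.+1])).
apply: psP => c /=; rewrite -GE; congr (quot_map _ _ _); apply: psP => v /=.
congr (pscoef (G _) _); apply/mnmP => i; rewrite mnmE ?mnm_rcons_lift //.
by rewrite mnm_rcons_max (ord1 i).
Qed.

(** The union of the [n] octants; the exponent of [T], at [ord_max], is unrestricted. *)
Definition cone_exp (w : 'X_{1..n.+2}) : Prop :=
  exists i : 'I_n, forall l, (w (lift ord_max l) != 0 -> cone_plane i l)%N.

Lemma cone_map_eq0 f : cone_map f = 0 <-> forall w, cone_exp w -> pscoef f w = 0.
Proof.
have sl c : cone_quot (ps_slice f c) = 0 <-> cone_ideal (ps_slice f c).
  exact: quot_map_eq0.
split => [f0 w|fw].
  have [v [c ->]] := mnm_rcons_surj w; move=> [i wi].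
  have /sl/cone_idealP : cone_quot (ps_slice f c) = 0.
    by have := congr1 (fun s => pscoef s c) f0.
  move=> H; apply: (H n2 i) => l vl; apply: wi.
  by rewrite mnm_rcons_lift.
apply: psP => c; apply/sl/(cone_idealP _ _) => // i v vi /=.
by apply: fw; exists i => l; rewrite mnm_rcons_lift; apply: vi.
Qed.

End ConeMap.

(** * The exponents of the cone as a chain of quadrants *)

Section ConeExponents.
Variables (n : nat).
Hypothesis n2 : (2 <= n)%N.

(** Renumbers the variables along the path, so that the [i]-th prime omits exactly the consecutive
    rays [i] and [i.+1]. *)
Definition cone_pos (p : nat) : 'I_n.+2 := lift ord_max (inZp (p + n.-1) : 'I_n.+1).
Notation top := (ord_max : 'I_n.+2).

Lemma inZp_pos_inj p q : (p <= n)%N -> (q <= n)%N ->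
  inZp (p + n.-1) = inZp (q + n.-1) :> 'I_n.+1 -> p = q.
Proof.
move=> pn qn /(congr1 val) /= /eqP.
by rewrite eqn_modDr !modn_small ?ltnS // => /eqP.
Qed.

Lemma cone_pos_inj p q : (p <= n)%N -> (q <= n)%N -> cone_pos p = cone_pos q -> p = q.
Proof. by move=> pn qn /lift_inj; apply: inZp_pos_inj. Qed.

Lemma cone_pos_top p : (p <= n)%N -> cone_pos p != top.
Proof. by move=> _; rewrite eq_sym; apply: neq_lift. Qed.

Lemma cone_pos_surj (l : 'I_n.+1) : exists2 p,
    (p <= n)%N & lift ord_max l = cone_pos p.
Proof.
(* The shift by 2 inverts the shift by [n.-1] modulo [n.+1]. *)
exists ((l + 2) %% n.+1)%N; first by rewrite -ltnS ltn_pmod.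
congr lift; apply: val_inj => /=.
rewrite modnDml -addnA [(2 + _)%N](_ : _ = n.+1) ?modnDr ?modn_small //.
by lia.
Qed.

Notation pt := (fan_pt cone_pos top).

Lemma cone_expP w : cone_exp (n := n) w <-> exists i a b c,
    (i < n)%N /\ w = pt i a b c.
Proof.
split => [[i wi]|[i [a [b [c [ni ->]]]]]]; last first.
  exists (Ordinal ni) => l; rewrite fan_ptE /cone_plane /cone_pos /=.
  rewrite !(inj_eq lift_inj) (negbTE (neq_lift _ _)) mul0n addn0 ![_ == l]eq_sym.
  by case: (l == _) => //; case: (l == _).
have ni := ltn_ord i.
exists i, (w (cone_pos i)), (w (cone_pos i.+1)), (w top); split=> //.
apply/mnmP => l; rewrite fan_ptE.
have pn : (cone_pos i.+1 == cone_pos i) = false.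
  by apply/eqP => /cone_pos_inj E; have := E ni (ltnW ni); lia.
case: (unliftP ord_max l) => [j ->|->]; last first.
  by rewrite !(negbTE (cone_pos_top _)) ?eqxx ?mul1n // ltnW.
rewrite (negbTE (neq_lift _ _)) mul0n addn0.
have [wj|wj] := eqVneq (w (lift ord_max j)) 0%N.
  rewrite wj; case: eqP => [->|_]; case: eqP => [->|_]; rewrite ?wj ?muln0 //.
have := wi j wj; rewrite /cone_plane => /orP[/eqP jE|/eqP jE].
  have -> : lift ord_max j = cone_pos i by rewrite jE.
  by rewrite eqxx pn mul1n mul0n addn0.
have -> : lift ord_max j = cone_pos i.+1 by rewrite jE.
by rewrite eqxx [cone_pos i == _]eq_sym pn mul1n mul0n.
Qed.

Lemma cone_exp0 : cone_exp (n := n) 0%MM.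
Proof. by exists (Ordinal (ltnW n2)) => l; rewrite mnm0E. Qed.

Definition cone_ord rho : set 'X_{1..n.+2} :=
  [set w | (rho <= mdeg w)%N \/ ~ cone_exp (n := n) w]%classic.

Section Bounds.
Variables (rho r : nat).
Hypothesis rr : forall w, ~ cone_ord rho w -> (mdeg w < r)%N.

Lemma cone_ord_ge : (n * (rho.-1 * rho * rho.+1) <= 6 * #|outside r (cone_ord
    rho)|)%N.
Proof.
case: rho rr => [|q] rr' /=; first by rewrite !mul0n muln0.
apply: (count_ge_simplex (ltnW n2) cone_pos_inj cone_pos_top rr').
move=> i a b c ni abc [|]; last by apply; apply/cone_expP; exists i, a, b.+1, c.
by rewrite /fan_pt !mdegD !mdegMn !mdeg1; lia.
Qed.

End Bounds.

(** The fan bound for the maximal ideal: its height is 1 at the origin and 0 elsewhere, so the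
    triangle sum is at most [6 + (n - 6) = n]. *)
Lemma cone_ord_le rho r : (0 < rho)%N ->
  (6 * #|outside r (cone_ord rho)| <= n * (rho * rho.+1 * rho.+2))%N.
Proof.
move=> rho0.
pose M : set 'X_{1..n.+2} := [set w | (0 < mdeg w)%N]%classic.
pose h (w : 'X_{1..n.+2}) : nat := (w == 0%MM).
have MD v w : M v -> M (v + w)%MM by rewrite /M /= mdegD; lia.
have hP w c : M (w + U_(top) *+ c)%MM <-> (h w <= c)%N.
  rewrite /M /h /= mdegD mdegMn mdeg1 -mdeg_eq0 mul1n.
  by case: eqP => [->|]; lia.
have posD p : (p <= n)%N -> M (U_(cone_pos p) *+ 1)%MM.
  by move=> _; rewrite /M /= mdegMn mdeg1.
have Mr w : ~ M w -> (mdeg w < 1)%N by rewrite /M /=; lia.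
have h0 : h 0%MM = 1%N by rewrite /h eqxx.
have := triangle_sum_le (ltnW n2) cone_pos_inj cone_pos_top MD hP posD Mr isT.
rewrite h0.
have : (#|outside 1 M| <= #|[set: unit]|)%N.
  apply: (@card_outside_le _ 1 M _ _ (fun=> 0%MM)) => w nw; exists tt;
    rewrite ?inE //.
  by apply/eqP; rewrite -mdeg_eq0; have := Mr w nw; lia.
rewrite cardsT card_unit => M1 tri.
have H1 v w : cone_ord rho v -> cone_ord rho (v + w)%MM.
  move=> [rv|nv]; [left|right]; first by rewrite mdegD; lia.
  move=> [i wi]; apply: nv; exists i => l vl; apply: wi.
  by rewrite mnmDE addn_eq0 negb_and vl.
have H2 w : ~ cone_ord rho w -> exists i a b c, (i < n)%N /\ w = pt i a b c.
  move=> nw; apply/cone_expP; apply: contrapT => nE; apply: nw; by right.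
have H3 x y z u v w : M u -> M v -> M w -> (x + y + z = rho)%N ->
   cone_ord rho (u *+ x + v *+ y + w *+ z)%MM.
  rewrite /M /= => Mu Mv Mw E; left; rewrite !mdegD !mdegMn -E.
  by rewrite !leq_add // leq_pmull.
have := count_le (ltnW n2) MD hP posD r rho0 H1 H2 H3.
set t := triangle_sum _ _ _ _ _ in tri *.
have tn : (t <= n)%N by lia.
move/leq_trans; apply.
by rewrite [leqRHS]mulnC leq_mul2l tn orbT.
Qed.

End ConeExponents.

(** * The Krull dimension is 3 *)

Section ConeRing.
Variables (k : fieldType) (n : nat) (n2 : (2 <= n)%N).
Notation Q := (powerseries n.+2 k).
Notation S := (powerseries 1 (polygonal_cone k n2)).
Notation top := (ord_max : 'I_n.+2).
Notation pt := (fan_pt (@cone_pos n) top).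
Local Notation phi := (@cone_map k n n2).
Local Open Scope classical_set_scope.

Let phi_surj s : exists f, phi f = s := cone_map_surj s.

Lemma ker_mon w : ~ cone_exp (n := n) w -> ker phi (psmon w).
Proof.
move=> nw; apply/cone_map_eq0 => v ve /=; case: eqP => // vw.
by case: nw; rewrite -vw.
Qed.

Lemma lead_cone_exp (J : set Q) w : ker phi `<=` J -> ~ lead J w ->
    cone_exp (n := n) w.
Proof.
move=> kJ nw; apply: contrapT => nE; apply: nw; apply: lead_mon.
exact/kJ/ker_mon.
Qed.

(* The series that vanish when the variables outside [U] are set to zero. *)
Definition coord_ideal (U : pred 'I_n.+2) : set Q :=
  [set f : Q | forall w : 'X_{1..n.+2}, (forall l, w l != 0 -> U l)%N ->
    pscoef f w = 0].

Lemma ps_domain (f g : Q) : f * g = 0 -> f = 0 \/ g = 0.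
Proof.
move=> fg0; apply: contrapT => /not_orP[f0 g0].
have ex (h : Q) : h <> 0 -> exists w, pscoef h w != 0 /\ above w h.
  move=> h0; apply: contrapT => H; apply: h0; apply: psP => a; apply/eqP.
  apply: contrapT => /negP /ex_lead[w [_ hw ah]]; apply: H; by exists w.
have [v [fv af]] := ex f f0; have [w [gw ag]] := ex g g0.
have [_] := above_lead af ag; rewrite fg0 => /esym/eqP.
by rewrite mulf_eq0 (negbTE fv) (negbTE gw).
Qed.

(** Exponents supported in [U] are closed under sums and summands, so the restriction [res] is
    multiplicative; the ideal is its kernel, and [Q] is a domain. *)
Lemma coord_ideal_prime U : is_prime_ideal (coord_ideal U).
Proof.
pose inU (w : 'X_{1..n.+2}) := [forall l, (w l != 0%N) ==> U l].
have inUP (w : 'X_{1..n.+2}) : reflect (forall l, w l != 0 -> U l)%N (inU w).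
  by apply: (iffP forallP) => H l; [move: (H l) => /implyP | apply/implyP/H].
have inUD v w : inU (v + w)%MM = inU v && inU w.
  apply/inUP/andP => [H|[/inUP Hv /inUP Hw] l].
    by split; apply/inUP => l vl; apply: H; rewrite mnmDE addn_eq0 negb_and vl ?orbT.
  by rewrite mnmDE addn_eq0 negb_and => /orP[/Hv|/Hw].
pose res (f : Q) : Q := PSeries (fun w => if inU w then pscoef f w else 0).
have resM f g : res (f * g) = res f * res g.
  apply: psP => a; rewrite [RHS]pscoefM [LHS]/=; case: ifP => ua.
    by apply: eq_bigr => b /eqP ab /=; move: ua; rewrite {1}ab inUD => /andP[-> ->].
  rewrite big1 // => b /eqP ab /=; move: ua; rewrite {1}ab inUD.
  by case: ifP; rewrite ?mul0r //= => _ ->; rewrite mulr0.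
have resP f : coord_ideal U f <-> res f = 0.
  split => [cf|rf w /inUP Uw].
    by apply: psP => w /=; case: inUP => // /cf.
  by have := congr1 (fun h : Q => pscoef h w) rf; rewrite /= Uw.
split; first split.
- by [].
- by move=> f g cf cg w Uw; rewrite pscoefD cf ?cg ?addr0.
- move=> a f /resP rf; apply/resP; by rewrite resM rf mulr0.
- move=> /(_ 0%MM) /= H; have /eqP : (1 : k) = 0.
    by rewrite -H ?eqxx // => l; rewrite mnm0E.
  by rewrite oner_eq0.
- move=> f g /resP; rewrite resM => /ps_domain[]/resP; by [left|right].
Qed.

Lemma coord_ideal_proper (U V : pred 'I_n.+2) l :
  (forall i, V i -> U i) -> U l -> ~~ V l -> coord_ideal U `<` coord_ideal V.
Proof.
move=> VU Ul Vl; split => [f Uf w Vw|].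
  by apply: Uf => i /Vw /VU.
move=> /(_ (psmon U_(l)%MM)) H; have /eqP : (1 : k) = 0.
  have <- : pscoef (psmon U_(l)%MM : Q) U_(l)%MM = 0; last by rewrite /= eqxx.
  apply: H => [w Vw|i]; last by rewrite mnm1E; case: (eqVneq l i) => [<-|].
  rewrite /=; case: eqP => // wl; case/negP: Vl; apply: Vw.
  by rewrite wl mnm1E eqxx.
by rewrite oner_eq0.
Qed.

(** Variables that are not neighbours on the path have product zero in the cone, so [P] contains all
    of them but two neighbours, which are parameters together with [T]. *)
Lemma adjacent_params (P : set Q) : is_prime_ideal P -> ker phi `<=` P ->
    has_params 3 P.
Proof.
move=> prP kP; have [idP _ PM] := prP.
pose x p : Q := psvar k (cone_pos n p).
have far p q : (p.+1 < q)%N -> (q <= n)%N -> P (x p) \/ P (x q).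
  move=> pq qn; apply: PM; rewrite /x !psvarE psmonM; apply/kP/ker_mon.
  move=> [i wi]; have ni := ltn_ord i.
  have near s : (s <= n)%N -> ((U_(cone_pos n p) +
    U_(cone_pos n q))%MM (cone_pos n s) != 0%N) ->
     s = i \/ s = i.+1.
    move=> sn /wi; rewrite /cone_plane => /orP[] /eqP /inZp_pos_inj E.
      by left; apply: E => //; apply: ltnW.
    by right; apply: E.
  have np : p = i \/ p = i.+1 by apply: near; rewrite ?mnmDE ?mnm1E ?eqxx //; lia.
  have nq : q = i \/ q = i.+1 by apply: near; rewrite ?mnmDE ?mnm1E ?eqxx ?addn1.
  by lia.
have [i [ni Pi]] : exists i, (i < n)%N /\
    forall p, (p <= n)%N -> p != i -> p != i.+1 -> P (x p).
  case: (EM (exists p, (p <= n)%N && `[< ~ P (x p) >])) => [exp|nexp]; last first.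
    exists 0%N; split; first exact: ltnW.
    move=> p pn _ _; apply: contrapT => nPp; apply: nexp.
    by exists p; rewrite pn; apply/asboolP.
  case: (ex_minnP exp) => p /andP[pn /asboolP nPp] pmin.
  have qmin q : (q <= n)%N -> ~ P (x q) -> (p <= q)%N.
    by move=> qn nPq; apply: pmin; rewrite qn; apply/asboolP.
  (* [p] is the first ray whose variable is outside [P]; the minimum covers [p = n], which only has
     a predecessor. *)
  exists (minn p n.-1); split; first by lia.
  move=> q qn q1 q2; apply: contrapT => nPq.
  have pq := qmin q qn nPq.
  case: (far p q) => //; by lia.
pose u (l : 'I_3) : Q := if l == 0 :> nat then x i else if l == 1%N :> nat then x
  i.+1 else psvar k top.
exists u; split.
  move=> l; have H j : ps_ord 1 (psvar k j : Q).
    by apply/ps_ord1P => /=; case: eqP => // /(congr1 mdeg); rewrite mdeg0 mdeg1.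
  by rewrite /u; case: ifP => _; [|case: ifP => _]; apply: H.
have idJ := ideal_plus_ideal u idP.
apply: (radical_vars_ord idJ) => l; exists 1%N; rewrite expr1.
have uJ j : ideal_plus P u (u j) by apply: ideal_plus_gen.
case: (unliftP ord_max l) => [l' ->|->].
  have [p pn ->] := cone_pos_surj n2 l'.
  have [->|pi] := eqVneq p i; first exact: (uJ (Ordinal (isT : (0 < 3)%N))).
  have [->|pi1] := eqVneq p i.+1; first exact: (uJ (Ordinal (isT : (1 < 3)%N))).
  by apply: ideal_plus_sub; apply: Pi.
exact: (uJ (Ordinal (isT : (2 < 3)%N))).
Qed.

Lemma krull_dim_cone : krull_dim S = 3%N.
Proof.
rewrite /krull_dim.
rewrite (@chain_lengths_hom Q S phi phi_surj _
   [set P | is_prime_ideal P /\ ker phi `<=` P]).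
- apply: nat_max_eq; last first.
    move=> h [c [cP cS]]; have [pr0 k0] := cP 0%N isT.
    apply: (@params_chain n.+2 k 3 h c) => //.
      by move=> i ih; case: (cP i ih).
    exact: adjacent_params.
  (* Variables not yet killed at stage [i]: the chain removes ray 1, then ray 0, then [T]. *)
  pose U i : pred 'I_n.+2 := fun l => [|| (i < 1)%N && (l == cone_pos n 1),
     (i < 2)%N && (l == cone_pos n 0) | (i < 3)%N && (l == top)].
  have n1 : (1 <= n)%N := ltnW n2.
  have e01 : (cone_pos n 0 == cone_pos n 1) = false.
    by apply/eqP => /cone_pos_inj E; have := E (leq0n n) n1.
  have e10 : (cone_pos n 1 == cone_pos n 0) = false by rewrite eq_sym.
  have e0t := negbTE (cone_pos_top (leq0n n)).
  have e1t := negbTE (cone_pos_top n1).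
  exists (fun i => coord_ideal (U i)); split => [i _|i i3].
    split; first exact: coord_ideal_prime.
    move=> f /cone_map_eq0 kf w Uw; apply: kf.
    exists (Ordinal n1) => l /Uw; rewrite /U /cone_plane /=.
    rewrite [lift _ _ == top]eq_sym (negbTE (neq_lift _ _)) andbF orbF.
    by case/orP => /andP[_ /eqP /lift_inj ->]; rewrite eqxx ?orbT.
  case: i i3 => [|[|[|i]]] // _.
  + apply: (@coord_ideal_proper _ _ (cone_pos n 1)); rewrite /U /= ?eqxx ?e10 ?e1t //.
    by move=> l /= ->; rewrite orbT.
  + apply: (@coord_ideal_proper _ _ (cone_pos n 0)); rewrite /U /= ?eqxx ?e0t //.
    by move=> l /= ->; rewrite orbT.
  + apply: (@coord_ideal_proper _ _ top); rewrite /U /= ?eqxx //.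
- by move=> P prP; split; [exact: preimage_prime | apply: ker_preimage; case: prP].
- by move=> P [prP kP]; apply: image_prime.
- by move=> P [[idP _ _] kP].
Qed.

End ConeRing.

(** * Primary ideals, their powers, and the powers of the maximal ideal *)

Section PrimaryIdeals.
Variables (k : fieldType) (n : nat) (n2 : (2 <= n)%N).
Notation Q := (powerseries n.+2 k).
Notation S := (powerseries 1 (polygonal_cone k n2)).
Notation top := (ord_max : 'I_n.+2).
Local Notation phi := (@cone_map k n n2).
Local Open Scope classical_set_scope.

Implicit Type I : set S.

Let phi_surj s : exists f, phi f = s := cone_map_surj s.

Lemma ker_coef0 (f : Q) : ker phi f -> pscoef f 0%MM = 0.
Proof. by move/cone_map_eq0; apply; apply: cone_exp0. Qed.

Lemma max_idealP (f : Q) : max_ideal (phi f) <-> pscoef f 0%MM = 0.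
Proof.
split => [nu|f0 [s]].
  apply/eqP; apply: contrapT => /negP /ps_unit[g fg]; apply: nu.
  by exists (phi g); rewrite -rmorphM fg rmorph1.
have [g <-] := phi_surj s; rewrite -rmorphM -(rmorph1 phi) => E.
have : pscoef (f * g - 1) 0%MM = 0 by apply: ker_coef0;
  rewrite /ker /= rmorphB E subrr.
by move/eqP; rewrite pscoefB pscoefM0 f0 mul0r pscoef1 eqxx sub0r oppr_eq0 oner_eq0.
Qed.

Lemma ideal_exp_ideal (I : set S) q : is_ideal (ideal_exp I q).
Proof. by case: q => [|q]; [split | apply: ideal_gen_ideal]. Qed.

Lemma ideal_expS (I : set S) q s t : I s -> ideal_exp I q t ->
    ideal_exp I q.+1 (s * t).
Proof. by move=> Is It C [_]; apply; exists s, t. Qed.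

Lemma ideal_exp1 (I : set S) : is_ideal I -> ideal_exp I 1 = I.
Proof.
move=> idI; apply/seteqP; split => [s|s Is]; last by rewrite -[s]mulr1;
  apply: ideal_expS.
by apply; split=> // _ [a [b [Ia _ ->]]]; apply: idealMr.
Qed.

Definition pull (I : set S) q : set Q := phi @^-1` ideal_exp I q.

Lemma pull1 I f : is_ideal I -> pull I 1 f <-> I (phi f).
Proof. by move=> idI; rewrite -[I in X in _ <-> X](ideal_exp1 idI). Qed.

Lemma pull_ideal I q : is_ideal (pull I q).
Proof. by apply: preimage_ideal; apply: ideal_exp_ideal. Qed.

Lemma pull_ker I q : ker phi `<=` pull I q.
Proof. by apply: ker_preimage; apply: ideal_exp_ideal. Qed.

Lemma pullS I q f g : pull I 1 f -> is_ideal I -> pull I q g -> pull I q.+1 (f * g).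
Proof.
move=> If idI Ig; have {}If := (pull1 f idI).1 If.
by rewrite /pull /= rmorphM; apply: (ideal_expS If).
Qed.

Lemma lead_pullD I q u x v : is_ideal I -> lead (pull I 1) u -> lead (pull I q) v ->
  lead (pull I (x + q)) (u *+ x + v)%MM.
Proof.
move=> idI lu lv; elim: x => [|x IH]; first by rewrite mulm0n add0m.
rewrite mulmS -addmA; apply: leadM lu IH => f g ff fg.
exact: pullS.
Qed.

Lemma lead_pull_triple I x y z u v w : is_ideal I ->
    lead (pull I 1) u -> lead (pull I 1) v -> lead (pull I 1) w ->
  lead (pull I (x + y + z)) (u *+ x + v *+ y + w *+ z)%MM.
Proof.
move=> idI lu lv lw; rewrite -!addnA -!addmA; apply: lead_pullD => //.
apply: lead_pullD => //; rewrite -[z in pull I z]addn0 -[(w *+ z)%MM]addm0.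
by apply: lead_pullD => //; apply: lead_mon.
Qed.

Lemma primary_ord I q : m_primary I -> exists r, ps_ord r `<=` pull I q.
Proof.
move=> [idI radI].
have [r rJ] : exists r, forall f : Q, ps_ord r f -> pull I q f; last by exists r.
apply: radical_vars_ord (pull_ideal I q) _ => i.
have [e Ie] : radical I (phi (psvar k i)).
  by rewrite radI; apply/max_idealP => /=; case: eqP => // /(congr1 mdeg);
    rewrite mdeg0 mdeg1.
exists (e * q)%N; rewrite /pull /= rmorphXn exprM.
elim: (q) => [|q' IH]; first by [].
by rewrite exprS; apply: ideal_expS.
Qed.

Lemma primary_proper I : m_primary I -> ~ I 1.
Proof.
move=> [idI radI] I1; have : radical I 1 by exists 0%N.
by rewrite radI => -[]; exists 1; rewrite mulr1.
Qed.

Lemma length_pull I q r : ps_ord r `<=` pull I q ->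
  length_quot (ideal_exp I q) = #|outside r (lead (pull I q))|.
Proof.
move=> rJ; rewrite (length_quot_hom phi_surj (ideal_exp_ideal I q)).
exact: (length_quot_outside (pull_ideal I q) rJ).
Qed.

Lemma outside_pull I q r w : ps_ord r `<=` pull I q -> ~ lead (pull I q) w ->
    (mdeg w < r)%N.
Proof.
move=> rJ nw; rewrite ltnNge; apply/negP => rw; apply: nw; apply: lead_mon; apply: rJ.
by apply: ps_ordW rw _; apply: ps_ord_mon.
Qed.

Lemma lead0 I : m_primary I -> ~ lead (pull I 1) 0%MM.
Proof.
move=> pI [f [If f0 _]]; apply: (primary_proper pI); have [idI _] := pI.
have [g fg] := ps_unit f0; rewrite -(rmorph1 phi) -fg rmorphM.
by apply: (idealMr idI); apply/pull1.
Qed.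

Lemma length_gt0 I : m_primary I -> (0 < length_quot I)%N.
Proof.
move=> pI; have [r rJ] := primary_ord 1 pI; have [idI _] := pI.
rewrite -{1}(ideal_exp1 idI) (length_pull rJ) card_gt0; apply/set0Pn.
have h0 := outside_pull rJ (lead0 pI).
by exists (BMultinom h0); apply/outsideP/lead0.
Qed.

(** The height over [w] is the least [c]; it exists because a power of [T] is in [M]. *)
Lemma ex_height (M : set 'X_{1..n.+2}) D : (forall v w, M v -> M (v + w)%MM) ->
    M (U_(top) *+ D)%MM ->
  exists h : 'X_{1..n.+2} -> nat, forall w c,
    M (w + U_(top) *+ c)%MM <-> (h w <= c)%N.
Proof.
move=> MD Mtop.
suff /choice[h hP] : forall w, exists h, forall c,
  M (w + U_(top) *+ c)%MM <-> (h <= c)%N.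
  by exists h.
move=> w; pose V c := `[< M (w + U_(top) *+ c)%MM >].
have exV : exists c, V c by exists D; apply/asboolP; rewrite addmC; apply: MD.
case: (ex_minnP exV) => h /asboolP Mh hmin; exists h => c; split => [Mc|hc].
  by apply: hmin; apply/asboolP.
have -> : (w + U_(top) *+ c = (w + U_(top) *+ h) + U_(top) *+ (c - h))%MM.
  by apply/mnmP => l; rewrite !(mnmDE, mulmnE, mnm1E) -{1}(subnK hc); ring.
exact: MD.
Qed.

Lemma length_exp_le I : m_primary I -> exists t, exists2 h0,
  (0 < h0)%N /\ (t + 6 * h0 <= 6 * length_quot I + n * h0)%N &
  forall q, (0 < q)%N -> (6 * length_quot (ideal_exp I q) <= q * q.+1 * q.+2 * t)%N.
Proof.
move=> pI; have [idI _] := pI; have [r rJ] := primary_ord 1 pI.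
pose M := lead (pull I 1).
have MD v w : M v -> M (v + w)%MM by apply: lead_add; apply: pull_ideal.
have MU l : M (U_(l) *+ r.+1)%MM.
  apply: lead_mon; apply: rJ; apply: (@ps_ordW _ _ r.+1) => //.
  by rewrite -[X in ps_ord X]mul1n -(mdeg1 l) -mdegMn; apply: ps_ord_mon.
have [h hP] := ex_height MD (MU top).
have posD p : (p <= n)%N -> M (U_(cone_pos n p) *+ r.+1)%MM by move=> _; apply: MU.
have Mr w : ~ M w -> (mdeg w < r)%N by apply: outside_pull.
have n0 := ltnW n2.
have tri := triangle_sum_le n0 (@cone_pos_inj n) (@cone_pos_top n) MD hP posD Mr
  (ltn0Sn r).
exists (triangle_sum n (cone_pos n) top h r.+1), (h 0%MM).
  split.
    rewrite ltnNge; apply/negP => /(hP 0%MM 0%N).2; rewrite mulm0n addm0.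
    exact: lead0.
  by rewrite -{1}(ideal_exp1 idI) (length_pull rJ).
move=> q q0; have [r' rJ'] := primary_ord q pI; rewrite (length_pull rJ').
apply: (count_le n0 MD hP posD) => //.
- by move=> v w; apply: lead_add; apply: pull_ideal.
- move=> w /(lead_cone_exp (pull_ker I q)) /(cone_expP n2)//.
- by move=> x y z u v w Mu Mv Mw <-; apply: lead_pull_triple.
Qed.

(* The image of the [j]-th power of the maximal ideal. *)
Definition max_power (j : nat) : set S := phi @` (ps_ord j : set Q).

Lemma max_power_ideal j : is_ideal (max_power j).
Proof. by apply: image_ideal => //; apply: ps_ord_ideal. Qed.

Lemma max_power_primary j : (0 < j)%N -> m_primary (max_power j).
Proof.
move=> j0; have idI := max_power_ideal j; split=> //.
apply/seteqP; split => s; have [f <-] := phi_surj s.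
  move=> [e [g gj gE]]; apply/max_idealP; apply: contrapT => /eqP /ps_unit[h fh].
  have : pscoef (g * h ^+ e - 1) 0%MM = 0.
    apply: ker_coef0; rewrite /ker /= rmorphB rmorphM /= gE rmorph1 -!rmorphXn
      -rmorphM.
    by rewrite -exprMn fh expr1n rmorph1 subrr.
  rewrite pscoefB pscoefM0 gj ?mdeg0 // mul0r pscoef1 eqxx sub0r => /eqP.
  by rewrite oppr_eq0 oner_eq0.
move/max_idealP/ps_ord1P => f1; exists j, (f ^+ j); last by rewrite rmorphXn.
by rewrite -[X in ps_ord X]muln1; apply: ps_ordX.
Qed.

Lemma max_power_exp j q : ideal_exp (max_power j) q `<=` max_power (j * q).
Proof.
elim: q => [|q IH]; first by rewrite muln0 => s _; have [f <-] := phi_surj s;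
  exists f.
move=> s; apply; split; first exact: max_power_ideal.
move=> _ [_ [b [[f fj <-] /IH[g gq <-] ->]]]; rewrite -rmorphM.
by exists (f * g) => //; rewrite mulnS; apply: ps_ordM.
Qed.

(** Kernel elements vanish on cone exponents, where members of the ideal thus agree with series of
    order at least [j * q]. Conversely, factors of degree [j] are split off a monomial one by
    one. *)
Lemma lead_max_power j q :
  lead (pull (max_power j) q) = @cone_ord n (j * q).
Proof.
apply/seteqP; split => w.
  move=> [f [/max_power_exp [g gq gf] fw _]];
    case: (EM (cone_exp (n := n) w)) => we; last by right.
  left; rewrite leqNgt; apply/negP => /gq gw; case/eqP: fw.
  have : pscoef (g - f) w = 0.
    by apply: (cone_map_eq0 n2 (g - f)).1 => //; rewrite rmorphB /= gf subrr.
  by rewrite pscoefB gw sub0r => /eqP; rewrite oppr_eq0 => /eqP.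
move=> [wq|nw]; last by apply/lead_mon/pull_ker/ker_mon.
elim: q w wq => [|q IH] w wq; first exact: lead_mon.
have jw : (j <= mdeg w)%N by apply: leq_trans wq; rewrite mulnS leq_addr.
have [b bj bw] := mnm_below jw.
rewrite -(submK bw) addmC;
  apply: (@leadM _ _ (pull (max_power j) 1) (pull (max_power j) q)).
- by move=> f g ff; apply: pullS => //; apply: max_power_ideal.
- apply: lead_mon; apply/pull1; first exact: max_power_ideal.
  by exists (psmon b) => //; rewrite -bj; apply: ps_ord_mon.
- apply: IH; move: wq; rewrite -{1}(submK bw) mdegD bj mulnS; lia.
Qed.

Lemma length_max_power j q : (0 < j)%N -> (0 < q)%N ->
  let l := length_quot (ideal_exp (max_power j) q) in
  (n * ((j * q).-1 * (j * q) * (j * q).+1) <= 6 * l)%N /\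
  (6 * l <= n * ((j * q) * (j * q).+1 * (j * q).+2))%N.
Proof.
move=> j0 q0 /=; have [r rJ] := primary_ord q (max_power_primary j0).
rewrite (length_pull rJ) lead_max_power; split.
  by apply: cone_ord_ge => // w; rewrite -lead_max_power; apply: outside_pull.
by apply: cone_ord_le => //; rewrite muln_gt0 j0.
Qed.

Lemma length_max : length_quot (max_power 1) = 1%N.
Proof.
apply/eqP; rewrite eqn_leq length_gt0 ?andbT; last exact: max_power_primary.
have [r rJ] := primary_ord 1 (max_power_primary (ltnSn 0)).
rewrite -(ideal_exp1 (max_power_ideal 1)) (length_pull rJ) lead_max_power.
apply: (@leq_trans #|[set: unit]%SET|); last by rewrite cardsT card_unit.
apply: (@card_outside_le _ r _ _ _ (fun=> 0%MM)) => w nw; exists tt; rewrite ?inE //.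
apply/eqP; rewrite -mdeg_eq0; apply: contrapT => /negP; rewrite -lt0n => w0.
by apply: nw; left; rewrite muln1.
Qed.

End PrimaryIdeals.

Arguments max_power k {n} n2 j _.

(** * Multiplicities *)

Import numFieldNormedType.Exports.

Section Limits.
Variable K : realType.
Local Open Scope classical_set_scope.

Lemma cvg_inv_nat : (fun q : nat => q%:R^-1 : K) @ \oo --> (0 : K).
Proof. by rewrite -cvg_shiftS; apply: cvg_harmonic. Qed.

(** The shape of both length bounds once divided by [q ^ 3]. *)
Lemma cvg_perturb (a x y : K) :
  (fun q : nat => a * (1 + x * q%:R^-1) * (1 + y * q%:R^-1)) @ \oo --> a.
Proof.
have H z : (fun q : nat => 1 + z * q%:R^-1 : K) @ \oo --> (1 : K).
  rewrite -[X in _ --> X]addr0 -[X in _ + X](mulr0 z).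
  by apply: cvgD; [exact: cvg_cst | apply: cvgM;
    [exact: cvg_cst | exact: cvg_inv_nat]].
have -> : nbhs a = nbhs (a * 1 * 1) by rewrite !mulr1.
by apply: cvgM => //; apply: cvgM => //; apply: cvg_cst.
Qed.

Lemma near_gt0 (P : nat -> Prop) : (forall q, (0 < q)%N -> P q) ->
    \forall q \near \oo, P q.
Proof. by move=> H; exists 1%N. Qed.

(* A divergent sequence has junk limit 0. *)
Lemma lim_le_perturb (u : nat -> K) (a x y : K) : 0 <= a ->
    (forall q, (0 < q)%N -> u q <= a * (1 + x * q%:R^-1) * (1 + y * q%:R^-1)) ->
  lim (u @ \oo) <= a.
Proof.
move=> a0 ua; case: (EM (cvg (u @ \oo))) => [cu|/dvgP ->]; last exact: a0.
by apply: (ler_cvg_to cu (@cvg_perturb a x y)); apply: near_gt0.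
Qed.

End Limits.

(** * Lech ratios and semistability *)

Section LechRatios.
Variables (K : realType) (k : fieldType) (n : nat) (n2 : (2 <= n)%N).
Notation S := (powerseries 1 (polygonal_cone k n2)).
Implicit Type I : set S.

Lemma multiplicityE I : multiplicity K I =
  lim ((fun q : nat => 6%:R * (length_quot (ideal_exp I q))%:R / q%:R ^+ 3 : K) @
    \oo)%classic.
Proof. by rewrite /multiplicity krull_dim_cone. Qed.

Lemma lech_ratioE I : lech_ratio K I = multiplicity K I / (6%:R * (length_quot I)%:R).
Proof. by rewrite /lech_ratio krull_dim_cone. Qed.

Lemma multiplicity_le I t :
    (forall q, (0 < q)%N -> (6 * length_quot (ideal_exp I q) <= q * q.+1 * q.+2 *
      t)%N) ->
  multiplicity K I <= t%:R.
Proof.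
move=> It; rewrite multiplicityE; apply: (@lim_le_perturb _ _ _ 1 2) => // q q0.
have q0' : 0 < q%:R :> K by rewrite ltr0n.
rewrite ler_pdivrMr ?exprn_gt0 // -natrM.
have -> : t%:R * (1 + 1 * q%:R^-1) * (1 + 2 * q%:R^-1) * q%:R ^+ 3 =
    (q * q.+1 * q.+2 * t)%:R :> K.
  by rewrite !natrM -[q.+2]addn2 -[q.+1]addn1 !natrD; field; rewrite lt0r_neq0.
by rewrite ler_nat; apply: It.
Qed.

(** Both bounds of [length_max_power], multiplied by 6, grow like [n * (j * q) ^ 3]. *)
Lemma multiplicity_max_power j : (0 < j)%N ->
  multiplicity K (max_power k n2 j) = (n * j ^ 3)%:R.
Proof.
move=> j0; rewrite multiplicityE; apply/cvg_lim => //.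
have j0' : j%:R != 0 :> K by rewrite pnatr_eq0 -lt0n.
apply: (squeeze_cvgr _ (@cvg_perturb K (n * j ^ 3)%:R (- j%:R^-1) j%:R^-1)
                       (@cvg_perturb K (n * j ^ 3)%:R j%:R^-1 (2 * j%:R^-1))).
apply: near_gt0 => q q0.
have q0' : 0 < q%:R :> K by rewrite ltr0n.
have q0'' : q%:R != 0 :> K by rewrite lt0r_neq0.
have [lo hi] := length_max_power k n2 j0 q0.
have jq0 : (0 < j * q)%N by rewrite muln_gt0 j0.
rewrite ler_pdivlMr ?exprn_gt0 // ler_pdivrMr ?exprn_gt0 // -natrM.
apply/andP; split.
  have -> : (n * j ^ 3)%:R * (1 + - j%:R^-1 * q%:R^-1) * (1 +
    j%:R^-1 * q%:R^-1) * q%:R ^+ 3 =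
      (n * ((j * q).-1 * (j * q) * (j * q).+1))%:R :> K.
    rewrite -subn1 -[(j * q).+1]addn1 !natrM natrB // natrD !natrM ?natrX.
    by field; rewrite j0' q0''.
  by rewrite ler_nat.
have -> : (n * j ^ 3)%:R * (1 + j%:R^-1 * q%:R^-1) * (1 +
  2 * j%:R^-1 * q%:R^-1) * q%:R ^+ 3 =
      (n * ((j * q) * (j * q).+1 * (j * q).+2))%:R :> K.
  rewrite -[(j * q).+2]addn2 -[(j * q).+1]addn1 !natrM !natrD !natrM ?natrX.
  by field; rewrite j0' q0''.
by rewrite ler_nat.
Qed.

Lemma lech_ratio_le1 I : m_primary I -> (n <= 6)%N -> lech_ratio K I <= 1.
Proof.
move=> pI n6; have [t [h0 [h00 tI] /multiplicity_le et]] := length_exp_le pI.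
have l0 := length_gt0 pI; rewrite lech_ratioE ler_pdivrMr; last first.
  by rewrite -natrM ltr0n muln_gt0.
by rewrite mul1r (le_trans et) // -natrM ler_nat; nia.
Qed.

Lemma lech_ratio_lt1 I : m_primary I -> (n <= 5)%N -> lech_ratio K I < 1.
Proof.
move=> pI n5; have [t [h0 [h00 tI] /multiplicity_le et]] := length_exp_le pI.
have l0 := length_gt0 pI; rewrite lech_ratioE ltr_pdivrMr; last first.
  by rewrite -natrM ltr0n muln_gt0.
by rewrite mul1r (le_lt_trans et) // -natrM ltr_nat; nia.
Qed.

Lemma lech_ratio_max : lech_ratio K (max_power k n2 1) = n%:R / 6%:R.
Proof. by rewrite lech_ratioE multiplicity_max_power // length_max exp1n muln1
  mulr1. Qed.

(** With [J = j.+1] the ratio is at least [J ^ 2 / ((J + 1) * (J + 2))], and [(J - 3) * (J + 1) * (J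
    + 2) = J ^ 3 - 7 * J - 6]. *)
Lemma lech_ratio_max_power j :
  1 - 3 * j.+1%:R^-1 <= lech_ratio K (max_power k n2 j.+1).
Proof.
have pI := max_power_primary k n2 (ltn0Sn j).
have l0 := length_gt0 pI; rewrite lech_ratioE multiplicity_max_power //
  ler_pdivlMr; last first.
  by rewrite -natrM ltr0n muln_gt0.
have [_ hi] := length_max_power k n2 (ltn0Sn j) (ltn0Sn 0).
rewrite (ideal_exp1 (max_power_ideal k n2 j.+1)) muln1 in hi.
set J := j.+1 in hi *.
have J0 : 0 < J%:R :> K by rewrite ltr0n.
have hiK : 6%:R * (length_quot (max_power k n2 J))%:R <=
    n%:R * (J%:R * (J%:R + 1) * (J%:R + 2)) :> K.
  move: hi; rewrite -(ler_nat K) -[J.+2]addn2 -[J.+1]addn1 !natrM !natrD.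
  by [].
case: (lerP (1 - 3 * J%:R^-1) (0 : K)) => [neg|pos].
  apply: (le_trans (y := 0)); last by rewrite ler0n.
  by rewrite mulr_le0_ge0 // mulr_ge0 // ler0n.
apply: (le_trans (ler_wpM2l (ltW pos) hiK)).
have -> : (1 - 3 * J%:R^-1) * (n%:R * (J%:R * (J%:R + 1) * (J%:R + 2))) =
    n%:R * ((J%:R - 3) * (J%:R + 1) * (J%:R + 2)) :> K.
  by field; rewrite lt0r_neq0.
rewrite natrM natrX ler_wpM2l ?ler0n //.
by nra.
Qed.

Lemma lech_mumford_ge I : m_primary I -> ((lech_ratio K I)%:E <= lech_mumford K S)%E.
Proof. by move=> pI; apply: ereal_sup_ubound; exists I. Qed.

Lemma semistable_le6 : semistable K (polygonal_cone k n2) -> (n <= 6)%N.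
Proof.
move=> ss; have := lech_mumford_ge (max_power_primary k n2 (ltnSn 0)).
rewrite ss lech_ratio_max lee_fin ler_pdivrMr ?ltr0n // mul1r ler_nat.
by [].
Qed.

Lemma semistable_cone : (n <= 6)%N -> semistable K (polygonal_cone k n2).
Proof.
move=> n6; rewrite /semistable; apply/eqP; rewrite eq_le; apply/andP; split.
  by apply: ge_ereal_sup => _ [I pI <-]; rewrite lee_fin; apply: lech_ratio_le1.
apply/lee_subgt0Pr => e e0.
have [j je] : exists j, 3 / e < j.+1%:R.
  exists (Num.bound (3 / e)); apply: (lt_le_trans (archi_boundP _)).
    by rewrite divr_ge0 // ltW.
  by rewrite ler_nat.
apply: (le_trans _ (lech_mumford_ge (max_power_primary k n2 (ltn0Sn j)))).
rewrite -EFinB lee_fin; apply: le_trans (lech_ratio_max_power j).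
rewrite lerD2l lerN2 ler_pdivrMr ?ltr0n // mulrC -ler_pdivrMr //; exact: ltW.
Qed.

End LechRatios.

Theorem proposition7p2p3 (K : realType) (k : fieldType) (n : nat)
    (n2 : (2 <= n)%N) :
  (semistable K (polygonal_cone k n2) <-> (2 <= n <= 6)%N) /\
  (stable K (polygonal_cone k n2) <-> (2 <= n <= 5)%N).
Proof.
rewrite n2 /=; split; first by split;
  [exact: semistable_le6 | exact: semistable_cone].
split => [[ss nat_]|n5]; last first.
  split; first by apply: semistable_cone; apply: leq_trans n5 _.
  move=> [I pI]; rewrite (semistable_cone K k n2 (leq_trans n5 (leqnSn 5))) => -[E].
  by have := lech_ratio_lt1 K pI n5; rewrite E ltxx.
have := semistable_le6 ss; rewrite leq_eqVlt => /orP[/eqP n6|//].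
(* For [n = 6] the maximal ideal has ratio 6 / 6 and attains the supremum. *)
case: nat_; exists (max_power k n2 1); first exact: max_power_primary.
rewrite lech_ratio_max ss; congr EFin.
by rewrite n6 divff // pnatr_eq0.
Qed.
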